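(* Let $\alpha\in[1,\infty]$, let $G_0$ be front-like and let $u$ be an advection of the form described in the context. Let $G^\epsilon$ solve $$G^\epsilon_t+\epsilon\,u(x,y,\epsilon^\alpha t)\cdot DG^\epsilon+|DG^\epsilon|=0\ \text{ in }\mathbb R^n\times\mathbb R_+,\qquad G^\epsilon=G_0\ \text{ on }\mathbb R^n\times\{0\},$$ and let $G^\epsilon_{\rm ptw}$ be the perturbed traveling wave defined in the context. Then, for all $t\in\mathbb R_+$, $\Gamma_t(G^\epsilon)=\Gamma_t(G^\epsilon_{\rm ptw})$. Moreover, $\{G^\epsilon\le0\}=\{G^\epsilon_{\rm ptw}\le0\}$.
   Context: Notation. $n\ge2$; points of $\mathbb R^n$ are written $(x,y)$ with $x\in\mathbb R^{n-1}$, $y\in\mathbb R$. $\mathbb R_\pm=\{y\in\mathbb R:0<\pm y<\infty\}$. $D$ is the gradient in $(x,y)$. Convention: $\epsilon^\infty=0$. For $\phi:\mathbb R^n\times\mathbb R_+\to\mathbb R$ and $t\in\mathbb R_+$, $\Gamma_t(\phi)=\{(x,y)\in\mathbb R^n:\phi(x,y,t)=0\}$. All functions may depend on $\omega$ in a probability space $(\Omega,\mathcal F,P)$ with expectation $E$; this dependence is suppressed. Solutions are viscosity solutions. Mild white noise. Let $\mathcal F_{y_1,y_2}=\sigma\{w(y):y_1\le y\le y_2\}$. A process $w:\mathbb R\times\Omega\to\mathbb R$ is mild white noise if (a) there is $M>0$ (taken $\ge1$) such that with probability one $\|w\|_{C^1(\mathbb R)}\le M$; (b) $E[w(y)]=0$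 for all $y$; (c) $w$ is stationary and strongly mixing with rate $p>3/2$, i.e. $\int_0^\infty\varrho(y)^{1/p}dy<\infty$, where $\varrho(y)=\sup_{y_1}\sup_{y_2\ge y_1}\sup_{A\in\mathcal F_{y_2+y,\infty},\,B\in\mathcal F_{y_1,y_2}}\frac{|P(A\cap B)-P(A)P(B)|}{P(B)}$. It is normalized by $2\int_0^\infty E[w(0)w(\xi)]\,d\xi=1$. Advection. $u(x,y,t)=(u_\perp(x,y,t),\,u_\parallel(x,t)w(y))$ with $w$ mild white noise, $u_\perp\in C^2(\mathbb R^n\times\mathbb R_+)^{n-1}$ and $u_\parallel\in C^2(\mathbb R^{n-1}\times\mathbb R_+)$, bounded together with their derivatives up to order two and extended continuously to $t=0$. Throughout, $\epsilon>0$ is such that $\epsilon\|u\|_{C^1}\le1/100$. Front-like. A function $G_0\in L^\infty_{loc}(\mathbb R^n)$ is front-like if there exist $\underline G,\overline G\in C^{0,1}_{loc}(\mathbb R)\cap C^1_{loc}(\mathbb R_-\cup\mathbb R_+)$ with $\underline G',\overline G'>0$, $\underline G(y)\le G_0(x,y)\le\overline G(y)$ for all $(x,y)$, and $\underline G(0)=\overline G(0)=0$. Perturbed traveling wave $G^\epsilon_{\rm ptw}$. Let $\rho^\epsilon$ be the unique globally Lipschitz solution of $\epsilon\,u(x,y,0)\cdot D\rho^\epsilon+|D\rho^\epsilon|=1$ in $\mathbb R^n$, $\rho^\epsilon=0$ on $\mathbb R^{n-1}\times\{0\}$, such that, uniformly in $x\in\mathbb R^{n-1}$, $\liminf_{y\to\infty}\rho^\epsilon(x,y)\ge0$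 and $\limsup_{y\to-\infty}\rho^\epsilon(x,y)\le0$. Then $G^\epsilon_{\rm ptw}$ is the solution of $G_t+\epsilon\,u(x,y,\epsilon^\alpha t)\cdot DG+|DG|=0$ in $\mathbb R^n\times\mathbb R_+$ with $G(\cdot,\cdot,0)=\rho^\epsilon$ (so $G^\epsilon_{\rm ptw}=\rho^\epsilon-t$ when $\alpha=\infty$). *)

(* Defs.v *)
From HB Require Import structures.
From mathcomp Require Import all_boot all_order all_algebra.
From mathcomp Require Import all_classical all_reals all_analysis.

Set Implicit Arguments.
Unset Strict Implicit.
Unset Printing Implicit Defensive.

Import Order.TTheory GRing.Theory Num.Theory.
Import numFieldNormedType.Exports.

Local Open Scope classical_set_scope.
Local Open Scope ring_scope.

(* The point (x, y) of R^n, with x in R^(n-1) and y in R. The norm that the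
   library puts on these products is the maximum norm; it is only used where
   the choice of an equivalent norm does not matter. *)
Notation euclid R n := ('rV[R]_(n.-1) * R)%type.
Notation spacetime R n := (euclid R n * R)%type.

Section euclidean.
Context {R : realType} {n : nat}.
Implicit Types p q : euclid R n.

Definition dotp p q : R := \sum_(i < n.-1) p.1 0 i * q.1 0 i + p.2 * q.2.

Definition enorm p : R := Num.sqrt (dotp p p).

Definition xdir (i : 'I_n.-1) : euclid R n := (delta_mx 0 i, 0).
Definition ydir : euclid R n := (0, 1).

(* The gradient in (x, y), read off the directional derivatives v |-> d v. *)
Definition gradient (d : euclid R n -> R) : euclid R n :=
  (\row_i d (xdir i), d ydir).

End euclidean.

Section regularity.
Context {R : realType} {V W : normedModType R}.

(* C^k regularity on an open set A. *)
Fixpoint Ck_on (k : nat) (A : set V) (f : V -> W) : Prop :=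
  match k with
  | 0%N => forall z, A z -> {for z, continuous f}
  | k'.+1 => (forall z, A z -> differentiable f z) /\
             (forall v, Ck_on k' A ('D_v f))
  end.

Fixpoint Ck_bounded_on (k : nat) (A : set V) (f : V -> W) : Prop :=
  [bounded f z | z in A] /\
  match k with
  | 0%N => True
  | k'.+1 => forall v, Ck_bounded_on k' A ('D_v f)
  end.

End regularity.

(* Viscosity solutions of F(z, Dg(z)) = 0 on an open subset A of V, in the sense
   of semicontinuous envelopes, so that g need not be continuous. The operator
   receives the differential of the test function as the map of its directional
   derivatives. *)
Section viscosity.
Context {R : realType} {V : normedModType R}.
Implicit Types (A : set V) (F : V -> (V -> R) -> R) (g phi : V -> R).

Definition locally_bounded_on A g :=
  forall z, A z -> exists M, \forall z' \near z, A z' -> `|g z'| <= M.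

(* The envelopes of the restriction of g to A. *)
Definition usc_env A g (z : V) : \bar R :=
  limf_esup (EFin \o g) (within A (nbhs z)).

Definition lsc_env A g (z : V) : \bar R :=
  limf_einf (EFin \o g) (within A (nbhs z)).

Definition viscosity_subsolution A F g :=
  forall phi z, A z -> Ck_on 1 A phi ->
    (\forall z' \near z,
      (usc_env A g z' - (phi z')%:E <= usc_env A g z - (phi z)%:E)%E) ->
    F z (fun v => 'D_v phi z) <= 0.

Definition viscosity_supersolution A F g :=
  forall phi z, A z -> Ck_on 1 A phi ->
    (\forall z' \near z,
      (lsc_env A g z - (phi z)%:E <= lsc_env A g z' - (phi z')%:E)%E) ->
    0 <= F z (fun v => 'D_v phi z).

Definition viscosity_solution A F g :=
  [/\ locally_bounded_on A g, viscosity_subsolution A F g &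
      viscosity_supersolution A F g].

End viscosity.

Section white_noise.
Context {R : realType} {d : measure_display} {Omega : measurableType d}.
Context {P : probability Omega R}.
Variable w : R -> {RV P >-> R}.

(* The sigma-algebra generated by the w(y), y in I. *)
Definition sigma_noise (I : set R) : set_system Omega :=
  <<s \bigcup_(y in I) preimage_set_system setT (w y) measurable >>.

Definition mixing_rate (y : R) : \bar R :=
  ereal_sup [set r : \bar R | exists y1 y2 A B,
    [/\ y1 <= y2, sigma_noise `[y2 + y, +oo[ A, sigma_noise `[y1, y2] B,
        (0 < P B)%E &
        r = (`|fine (P (A `&` B)) - fine (P A) * fine (P B)| / fine (P B))%:E]].

Definition stationary := forall (k : nat) (y : k.-tuple R) (h : R)
    (B : set (k.-tuple (measurableTypeR R))), measurable B ->
  P [set om | B [tuple w (tnth y i + h) om | i < k]] =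
  P [set om | B [tuple w (tnth y i) om | i < k]].

Definition strongly_mixing (p : R) :=
  (\int[lebesgue_measure]_(y in `[0%R, +oo[) (mixing_rate y `^ p^-1) < +oo)%E.

Definition mild_white_noise :=
  [/\ exists2 M : R, 1 <= M &
        {ae P, forall om, Ck_on 1 setT (fun y => w y om) /\
          (ereal_sup (range (fun y => `|w y om|%:E)) +
           ereal_sup (range (fun y => `|derive1 (fun s => w s om) y|%:E)) <=
           M%:E)%E},
      forall y, 'E_P[w y]%E = 0%E,
      stationary,
      exists2 p : R, 3 / 2 < p & strongly_mixing p &
      (2%:E * \int[lebesgue_measure]_(xi in `[0%R, +oo[)
                'E_P[fun om => (w 0 om * w xi om)%R] = 1)%E].

End white_noise.

Section advection.
Context {R : realType} {n : nat}.

Definition positive_time {V : Type} : set (V * R) := [set p | 0 < p.2].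
Definition nonneg_time {V : Type} : set (V * R) := [set p | 0 <= p.2].

Definition advection (uperp : spacetime R n -> 'rV[R]_n.-1)
    (upar : 'rV[R]_n.-1 * R -> R) (w : R -> R) : spacetime R n -> euclid R n :=
  fun p => (uperp p, upar (p.1.1, p.2) * w p.1.2).

(* The values of f at negative times are irrelevant. *)
Definition advection_coefficient {V W : normedModType R} (f : V * R -> W) :=
  [/\ Ck_on 2 positive_time f, Ck_bounded_on 2 positive_time f &
      {within nonneg_time, continuous f}].

(* sup |u| + sup |Du| over R^n x (0, +oo), where Du includes the time derivative
   and its size is the Frobenius norm. *)
Definition C1_norm (u : spacetime R n -> euclid R n) : \bar R :=
  let jac_norm p := Num.sqrt
    (\sum_(i < n.-1) enorm ('D_(xdir i, 0) u p) ^+ 2 +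
     enorm ('D_(ydir, 0) u p) ^+ 2 + enorm ('D_(0, 1) u p) ^+ 2) in
  (ereal_sup [set (enorm (u p))%:E | p in positive_time] +
   ereal_sup [set (jac_norm p)%:E | p in positive_time])%E.

End advection.

Section front_like.
Context {R : realType} {n : nat}.
Implicit Types (A N : set (euclid R n)) (g : euclid R n -> R).

Definition box_volume (a b : euclid R n) : R :=
  (\prod_(i < n.-1) Num.max 0 (b.1 0 i - a.1 0 i)) * Num.max 0 (b.2 - a.2).

Definition box (a b : euclid R n) : set (euclid R n) :=
  [set z : euclid R n |
    (forall i, a.1 0 i <= z.1 0 i <= b.1 0 i) /\ a.2 <= z.2 <= b.2].

Definition lebesgue_null N := forall e : R, 0 < e ->
  exists a b : nat -> euclid R n, N `<=` \bigcup_k box (a k) (b k) /\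
    (\sum_(0 <= k <oo) (box_volume (a k) (b k))%:E <= e%:E)%E.

Definition lebesgue_measurable A :=
  exists2 B, <<s open >> B & lebesgue_null (A `+` B).

Definition Linfty_loc g :=
  (forall c, lebesgue_measurable [set z | c < g z]) /\
  (forall K, compact K -> exists2 N, lebesgue_null N &
    exists M, forall z, K z -> ~ N z -> `|g z| <= M).

Definition front_like g := Linfty_loc g /\
  exists Glow Gup : R -> R,
  [/\ forall a b, [lipschitz Glow y | y in `[a, b]] /\
                  [lipschitz Gup y | y in `[a, b]],
      Ck_on 1 [set y | y != 0] Glow /\ Ck_on 1 [set y | y != 0] Gup,
      forall y, y != 0 -> 0 < derive1 Glow y /\ 0 < derive1 Gup y,
      forall z, Glow z.2 <= g z <= Gup z.2 &
      Glow 0 = 0 /\ Gup 0 = 0].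

End front_like.

Section G_equation.
Context {R : realType} {n : nat}.
Implicit Types (eps : R) (alpha : \bar R) (u : spacetime R n -> euclid R n)
  (G : spacetime R n -> R) (rho g : euclid R n -> R).

(* eps ^ alpha for alpha in [1, +oo], with eps ^ oo = 0. *)
Definition epow eps alpha : R := if alpha is a%:E then eps `^ a else 0.

(* G_t + eps u(x, y, eps^alpha t) . DG + |DG| *)
Definition G_operator eps alpha u (p : spacetime R n)
    (d : spacetime R n -> R) : R :=
  let DG := gradient (fun v => d (v, 0)) in
  d (0, 1) + eps * dotp (u (p.1, epow eps alpha * p.2)) DG + enorm DG.

(* The solution takes the value g at time 0, and the initial condition holds in
   the sense of semicontinuous envelopes, as g may be discontinuous. *)
Definition G_solution eps alpha u g G :=
  [/\ viscosity_solution positive_time (G_operator eps alpha u) G,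
      locally_bounded_on nonneg_time G,
      forall z, G (z, 0) = g z &
      forall z : euclid R n,
        (usc_env nonneg_time G (z, 0%R) <= usc_env setT g z)%E /\
        (lsc_env setT g z <= lsc_env nonneg_time G (z, 0%R))%E].

(* eps u(x, y, 0) . D rho + |D rho| - 1 *)
Definition ptw_operator eps u (z : euclid R n) (d : euclid R n -> R) : R :=
  eps * dotp (u (z, 0)) (gradient d) + enorm (gradient d) - 1.

Definition ptw_profile eps u rho :=
  [/\ lipschitz rho,
      viscosity_solution setT (ptw_operator eps u) rho,
      forall x, rho (x, 0) = 0,
      forall e : R, 0 < e -> \forall y \near +oo, forall x, - e <= rho (x, y) &
      forall e : R, 0 < e -> \forall y \near -oo, forall x, rho (x, y) <= e].

Definition perturbed_traveling_wave eps alpha u G :=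
  exists2 rho, ptw_profile eps u rho & G_solution eps alpha u rho G.

Definition zero_level_set G (t : R) : set (euclid R n) :=
  [set z | G (z, t) = 0].

Definition nonpos_set G : set (spacetime R n) :=
  [set p | positive_time p /\ G p <= 0].

End G_equation.

(* Main.v *)
Require Import Defs.
From HB Require Import structures.
From mathcomp Require Import all_boot all_order all_algebra.
From mathcomp Require Import all_classical all_reals all_analysis.
From mathcomp Require Import ring lra.

(** The G-equation is geometric: flattening the unknown by an increasing function
    preserves sub- and supersolutions. With a flattening that is logarithmic at
    +oo and linear at -oo, doubling the variables shows that if every point has
    g <= -d or V >= d at t = 0, for a subsolution g, a supersolution V and some
    d > 0, then g > 0 > V never holds; the penalization by a function of
    e^(2t) (1 + |z - z0|^2) uses the finite speed of propagation. Small shifts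
    of G and G_ptw turn this into the four implications between their signs, once
    the data are squeezed between increasing functions of y vanishing at 0. For
    a front-like function this is the definition. For the profile rho of the
    travelling wave, cone comparison gives rho(z) - rho(z') <= 11/10 |z - z'|
    and, on every sphere of radius r about z, a point where
    rho <= rho(z) - 9/10 r. Descending from a near-minimizer in y >= 0 gives
    rho >= 9/10 y there, and descending a distance h from (x, 0) lands close to
    (x, -h), so that rho(x, -h) <= -h/5. *)

Set Implicit Arguments.
Unset Strict Implicit.
Unset Printing Implicit Defensive.

Import Order.TTheory GRing.Theory Num.Theory.
Import numFieldNormedType.Exports.

Local Open Scope classical_set_scope.
Local Open Scope ring_scope.

(** * Euclidean inner product and norm *)

Section euclidean_norm.
Context {R : realType} {n : nat}.
Implicit Types p q z : euclid R n.

Lemma dotpC p q : dotp p q = dotp q p.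
Proof.
by rewrite /dotp mulrC; congr (_ + _); apply: eq_bigr => i _; rewrite mulrC.
Qed.

Lemma dotpDl p q z : dotp (p + q) z = dotp p z + dotp q z.
Proof.
rewrite /dotp /= addrACA -mulrDl -big_split /=; congr (_ + _).
by apply: eq_bigr => i _; rewrite mxE mulrDl.
Qed.

Lemma dotpZl a p z : dotp (a *: p) z = a * dotp p z.
Proof.
rewrite /dotp /= mulrDr mulr_sumr -mulrA; congr (_ + _).
by apply: eq_bigr => i _; rewrite mxE mulrA.
Qed.

Lemma dotpNl p z : dotp (- p) z = - dotp p z.
Proof. by rewrite -scaleN1r dotpZl mulN1r. Qed.

Lemma dotpBl p q z : dotp (p - q) z = dotp p z - dotp q z.
Proof. by rewrite dotpDl dotpNl. Qed.

Lemma dotpDr p q z : dotp z (p + q) = dotp z p + dotp z q.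
Proof. by rewrite dotpC dotpDl !(dotpC z). Qed.

Lemma dotpZr a p z : dotp z (a *: p) = a * dotp z p.
Proof. by rewrite dotpC dotpZl !(dotpC z). Qed.

Lemma dotpNr p z : dotp z (- p) = - dotp z p.
Proof. by rewrite dotpC dotpNl !(dotpC z). Qed.

Lemma dotpp_ge0 p : 0 <= dotp p p.
Proof.
by rewrite addr_ge0 -?expr2 ?sqr_ge0// sumr_ge0// => i _; rewrite -expr2 sqr_ge0.
Qed.

Lemma enorm_ge0 p : 0 <= enorm p. Proof. exact: sqrtr_ge0. Qed.

Lemma sqr_enorm p : enorm p ^+ 2 = dotp p p.
Proof. by rewrite sqr_sqrtr ?dotpp_ge0. Qed.

Lemma enormZ a p : enorm (a *: p) = `|a| * enorm p.
Proof. by rewrite /enorm dotpZl dotpZr mulrA -expr2 sqrtrM ?sqr_ge0// sqrtr_sqr. Qed.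

Lemma enormN p : enorm (- p) = enorm p.
Proof. by rewrite -scaleN1r enormZ normrN1 mul1r. Qed.

Lemma enormB p q : enorm (p - q) = enorm (q - p).
Proof. by rewrite -enormN opprB. Qed.

Lemma sqr_distC p q : dotp (p - q) (p - q) = dotp (q - p) (q - p).
Proof. by rewrite -!sqr_enorm enormB. Qed.

Lemma sqr_dotp_le p q : dotp p q ^+ 2 <= dotp p p * dotp q q.
Proof.
have H a b : 0 <= a ^+ 2 * dotp p p + 2 * a * b * dotp p q + b ^+ 2 * dotp q q.
  have := dotpp_ge0 (a *: p + b *: q).
  rewrite !(dotpDl, dotpDr, dotpZl, dotpZr) (dotpC q p).
  by move/le_trans; apply; rewrite le_eqVlt; apply/orP; left; apply/eqP; ring.
have p0 := dotpp_ge0 p; have q0 := dotpp_ge0 q.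
(* These two choices give [dotp q q] and [dotp p p] times the Gram determinant; the coefficients 1
   and -1 settle the case where both factors vanish. *)
have := H (dotp q q) (- dotp p q); have := H (- dotp p q) (dotp p p).
have := H 1 1; have := H 1 (-1).
move: p0 q0; set a := dotp p p; set b := dotp p q; set c := dotp q q.
rewrite !le_eqVlt => /orP[/eqP<-|a0] /orP[/eqP<-|c0]; rewrite -!le_eqVlt => h1 h2 h3 h4.
- have -> : b = 0 by lra.
  by rewrite expr2 !mulr0.
- have : 0 <= c * (- b ^+ 2) by move/le_trans: h4; apply; lra.
  by rewrite pmulr_rge0//; lra.
- have : 0 <= a * (- b ^+ 2) by move/le_trans: h3; apply; lra.
  by rewrite pmulr_rge0//; lra.
- have : 0 <= c * (a * c - b ^+ 2) by move/le_trans: h4; apply; lra.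
  by rewrite pmulr_rge0//; lra.
Qed.

Lemma normr_dotp_le p q : `|dotp p q| <= enorm p * enorm q.
Proof.
rewrite -ler_sqr ?nnegrE ?mulr_ge0 ?enorm_ge0//.
by rewrite exprMn !sqr_enorm real_normK ?num_real// sqr_dotp_le.
Qed.

Lemma enormD p q : enorm (p + q) <= enorm p + enorm q.
Proof.
rewrite -ler_sqr ?nnegrE ?addr_ge0 ?enorm_ge0// sqr_enorm sqrrD !sqr_enorm.
rewrite dotpDl !dotpDr (dotpC q p).
have := le_trans (ler_norm _) (normr_dotp_le p q); rewrite mulr2n; lra.
Qed.

Lemma normr_coord_le p i : `|p.1 0 i| <= enorm p.
Proof.
rewrite -[leLHS]sqrtr_sqr ler_sqrt ?dotpp_ge0// /dotp (bigD1 i)//= -addrA -expr2.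
rewrite lerDl addr_ge0 -?expr2 ?sqr_ge0// sumr_ge0// => j _.
by rewrite -expr2 sqr_ge0.
Qed.

Lemma normr_height_le p : `|p.2| <= enorm p.
Proof.
rewrite -[leLHS]sqrtr_sqr ler_sqrt ?dotpp_ge0// /dotp -expr2.
by rewrite lerDr sumr_ge0// => j _; rewrite -expr2 sqr_ge0.
Qed.

Lemma normr_le_enorm p : `|p| <= enorm p.
Proof.
rewrite prod_normE /= ge_max normr_height_le andbT.
rewrite [leLHS]/Num.norm /= mx_normrE; apply/bigmax_leP.
split=> [|[i j] _ /=]; first exact: enorm_ge0.
by rewrite ord1; exact: normr_coord_le.
Qed.

Lemma enorm_eq0 p : enorm p = 0 -> p = 0.
Proof. by move=> h; apply/eqP; rewrite -normr_le0 -h normr_le_enorm. Qed.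

Lemma euclid_basis p :
  p = \sum_(i < n.-1) p.1 0 i *: (xdir i : euclid R n) + p.2 *: ydir.
Proof.
have fstE (F : 'I_n.-1 -> euclid R n) : (\sum_i F i).1 = \sum_i (F i).1.
  by elim/big_rec2 : _ => // i y x _ <-.
have sndE (F : 'I_n.-1 -> euclid R n) : (\sum_i F i).2 = \sum_i (F i).2.
  by elim/big_rec2 : _ => // i y x _ <-.
rewrite [LHS]surjective_pairing [RHS]surjective_pairing /= fstE sndE; congr (_, _).
  by rewrite scaler0 addr0 [LHS]row_sum_delta.
by rewrite big1 ?add0r => [|i _]; rewrite /= /GRing.scale /= ?mulr1 ?mulr0.
Qed.

(** The spatial differentials of the test functions are brought to the form [dotp X], whose gradient
    is then read off as [X]. *)
Lemma gradient_dotp p : gradient (dotp p) = p.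
Proof.
rewrite /gradient [RHS]surjective_pairing; congr (_, _).
  apply/rowP => i; rewrite mxE /dotp /= mulr0 addr0 (bigD1 i)//= mxE !eqxx mulr1.
  by rewrite big1 ?addr0// => j ji; rewrite mxE eqxx (negbTE ji) mulr0.
by rewrite /dotp /= mulr1 big1 ?add0r// => i _; rewrite mxE mulr0.
Qed.

End euclidean_norm.

(** * Calculus of continuously differentiable test functions *)

Section continuously_differentiable.
Context {R : realType} {V : normedModType R}.
Implicit Types (f g : V -> R) (df dg : V -> V -> R).

(** The differential is carried explicitly, so that test functions come with their derivatives; its
    continuity is asked direction by direction, as in [Ck_on]. *)
Definition C1 f df :=
  (forall z, is_diff z f (df z)) /\ (forall v, continuous (df ^~ v)).

Lemma C1_continuous f df : C1 f df -> continuous f.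
Proof.
by move=> [h _] z; have [d _] := h z; exact: differentiable_continuous.
Qed.

Lemma C1_derive f df z v : C1 f df -> 'D_v f z = df z v.
Proof. by move=> [h _]; have [d e] := h z; rewrite deriveE// e. Qed.

Lemma C1_Ck_on (A : set V) f df : C1 f df -> Ck_on 1 A f.
Proof.
move=> C1f; have [h c] := C1f; split=> [z _|v z _]; first by have [] := h z.
have -> : 'D_v f = df ^~ v by apply/funext => y; exact: C1_derive.
exact: c.
Qed.

Lemma C1_linear f : (forall a x y, f (a *: x + y) = a * f x + f y) ->
  continuous f -> C1 f (fun=> f).
Proof.
move=> lf cf; split=> [z|v]; last exact: cst_continuous.
have lf' : linear (f : V -> R^o) by [].
pose fM := GRing.isLinear.Build _ _ _ _ _ lf'.
pose fL : {linear V -> R^o} := HB.pack (f : V -> R^o) fM.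
apply: DiffDef; first exact: (linear_differentiable (f := fL)).
exact: (diff_lin (f := fL)).
Qed.

Lemma C1_cst a : C1 (fun=> a) (fun _ _ => 0).
Proof. by split=> [z|v]; [exact: is_diff_cst|exact: cst_continuous]. Qed.

Lemma C1D f g df dg : C1 f df -> C1 g dg ->
  C1 (fun z => f z + g z) (fun z v => df z v + dg z v).
Proof.
move=> [hf cf] [hg cg]; split=> [z|v z].
  exact: (is_diffD (hf z) (hg z)).
by apply: continuousD; [exact: cf|exact: cg].
Qed.

Lemma C1M f g df dg : C1 f df -> C1 g dg ->
  C1 (fun z => f z * g z) (fun z v => f z * dg z v + g z * df z v).
Proof.
move=> C1f C1g; have [hf cf] := C1f; have [hg cg] := C1g; split=> [z|v z].
  exact: (is_diffM (hf z) (hg z)).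
apply: cvgD; apply: cvgM.
- exact: C1_continuous C1f _.
- exact: cg.
- exact: C1_continuous C1g _.
- exact: cf.
Qed.

Lemma C1_eq f df dg : C1 f df -> (forall z v, df z v = dg z v) -> C1 f dg.
Proof.
by move=> h e; have -> : dg = df by apply/funext => z; apply/funext => v.
Qed.

Lemma C1Z a f df : C1 f df -> C1 (fun z => a * f z) (fun z v => a * df z v).
Proof.
by move=> h; apply: C1_eq (C1M (C1_cst a) h) _ => z v; rewrite mulr0 addr0.
Qed.

Lemma C1_sum (I : Type) (r : seq I) (F : I -> V -> R) (dF : I -> V -> V -> R) :
  (forall i, C1 (F i) (dF i)) ->
  C1 (fun z => \sum_(i <- r) F i z) (fun z v => \sum_(i <- r) dF i z v).
Proof.
move=> h; elim: r => [|i r IH].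
  rewrite [X in C1 X](_ : _ = fun=> 0); last by apply/funext => z; rewrite big_nil.
  by apply: C1_eq (C1_cst 0) _ => z v; rewrite big_nil.
rewrite [X in C1 X](_ : _ = fun z => F i z + \sum_(j <- r) F j z); last first.
  by apply/funext => z; rewrite big_cons.
by apply: C1_eq (C1D (h i) IH) _ => z v; rewrite big_cons.
Qed.

Lemma C1_comp (h h' : R -> R) f df : C1 f df ->
  (forall z, is_derive (f z) 1 h (h' (f z))) ->
  (forall z, {for f z, continuous h'}) ->
  C1 (fun z => h (f z)) (fun z v => h' (f z) * df z v).
Proof.
move=> C1f hd ch; have [hf cf] := C1f; split=> [z|v z].
  have [hd1 hd2] := hd z.
  have dh : differentiable h (f z) by apply/derivable1_diffP.
  have hh : is_diff (f z) h (fun s => h' (f z) * s).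
    apply: DiffDef => //; apply/funext => s.
    have -> : 'd h (f z) s = 'd h (f z) (s *: (1:R)) by rewrite [s *: _]mulr1.
    by rewrite linearZ /= -deriveE// hd2 mulrC.
  exact: (is_diff_comp (hf z) hh).
apply: cvgM; last exact: cf.
by apply: (@continuous_comp _ _ _ f h' z); [exact: C1_continuous C1f _|exact: ch].
Qed.

End continuously_differentiable.

Lemma C1_precomp {R : realType} {U V : normedModType R} (l : U -> V)
    (f : V -> R) df :
  (forall a x y, l (a *: x + y) = a *: l x + l y) -> continuous l -> C1 f df ->
  C1 (fun z => f (l z)) (fun z v => df (l z) (l v)).
Proof.
move=> ll cl [hf cf]; split=> [z|v z].
  have ll' : linear l by [].
  pose lM := GRing.isLinear.Build _ _ _ _ _ ll'.
  pose lL : {linear U -> V} := HB.pack l lM.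
  have hl : is_diff z l l.
    apply: DiffDef; first exact: (linear_differentiable (f := lL)).
    exact: (diff_lin (f := lL)).
  exact: (is_diff_comp hl (hf (l z))).
by apply: (@continuous_comp _ _ _ l (df ^~ (l v)) z); [exact: cl|exact: cf].
Qed.

(** * Derivatives and continuity of Euclidean distances *)

Section dotp_calculus.
Context {R : realType} {n : nat}.

Lemma continuous_coord (i : 'I_n.-1) : continuous (fun z : euclid R n => z.1 0 i).
Proof.
move=> z; apply: (@continuous_comp _ _ _ fst (fun x : 'rV[R]_n.-1 => x 0 i)).
  exact: cvg_fst.
exact: coord_continuous.
Qed.

Lemma C1_sqr_dist (z0 : euclid R n) :
  C1 (fun z => dotp (z - z0) (z - z0)) (fun z v => 2 * dotp (z - z0) v).
Proof.
have C1coord i : C1 (fun z : euclid R n => z.1 0 i) (fun _ v => v.1 0 i).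
  apply: C1_linear; last exact: continuous_coord.
  by move=> a x y; rewrite !mxE.
have C1height : C1 (fun z : euclid R n => z.2) (fun _ v => v.2).
  by apply: C1_linear => // z; exact: cvg_snd.
have C1c i := C1D (C1coord i) (C1_cst (- z0.1 0 i)).
have C1h := C1D C1height (C1_cst (- z0.2)).
have := C1D (C1_sum (index_enum 'I_n.-1) (fun i => C1M (C1c i) (C1c i))) (C1M C1h C1h).
rewrite [X in C1 X](_ : _ = fun z => dotp (z - z0) (z - z0)); last first.
  by apply/funext => z; rewrite /dotp; congr (_ + _); apply: eq_bigr => i _; rewrite !mxE.
move=> h; apply: C1_eq h _ => z v; rewrite /dotp /= [RHS]mulrDr mulr_sumr; congr (_ + _).
  by apply: eq_bigr => i _; rewrite !mxE; ring.
by ring.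
Qed.

Lemma continuous_dotpl (a : euclid R n) : continuous (fun z => dotp a z).
Proof.
(* In the direction a / 2, the differential at z of the squared distance to 0 is [dotp a z]. *)
have [_ /(_ (2^-1 *: a)) c] := C1_sqr_dist 0.
move=> z; move: (c z); rewrite /continuous_at subr0.
have e y : 2 * dotp (y - 0) (2^-1 *: a) = dotp a y.
  by rewrite subr0 dotpZr dotpC mulrA divff ?mul1r// pnatr_eq0.
by under eq_fun do rewrite e; rewrite -[in X in _ --> X](subr0 z) e.
Qed.

Lemma continuous_enorm : continuous (fun z : euclid R n => enorm z).
Proof.
move=> z; apply: (@continuous_comp _ _ _ (fun z : euclid R n => dotp z z) Num.sqrt).
  have := C1_continuous (C1_sqr_dist 0); move=> /(_ z).
  by under eq_fun do rewrite subr0.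
exact: sqrt_continuous.
Qed.

Lemma cvg_enorm (T : Type) (F : set_system T) (f : T -> euclid R n) (l : euclid R n) :
  f x @[x --> F] --> l -> enorm (f x) @[x --> F] --> enorm l.
Proof. by move=> h; apply: (cvg_comp _ _ h); exact: continuous_enorm. Qed.

Lemma enorm_lipschitz_continuous (f : euclid R n -> R) (L : R) : 0 < L ->
  (forall z z', f z - f z' <= L * enorm (z - z')) -> continuous f.
Proof.
move=> L0 lip z; apply/cvgrPdist_lt => e e0; near=> z'.
have h z1 z2 : `|f z1 - f z2| <= L * enorm (z1 - z2).
  by rewrite ler_norml lerNl opprB {1}enormB !lip.
apply: le_lt_trans (h _ _) _; rewrite mulrC -ltr_pdivlMr//; near: z'.
have c : enorm (z - z') @[z' --> z] --> (0 : R).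
  have e0' : enorm (z - z) = 0 by rewrite subrr -(scale0r 0) enormZ normr0 mul0r.
  by rewrite -e0'; apply: cvg_enorm; apply: cvgB; [exact: cvg_cst|exact: cvg_id].
by move/cvgr_lt : c => /(_ _ (divr_gt0 e0 L0)).
Unshelve. all: by end_near. Qed.

Lemma cvg_dotpr (T : Type) (F : set_system T) (f : T -> euclid R n) (l a : euclid R n) :
  f x @[x --> F] --> l -> dotp a (f x) @[x --> F] --> dotp a l.
Proof. by move=> h; apply: (cvg_comp _ _ h); exact: continuous_dotpl. Qed.

End dotp_calculus.

(** * Maxima of upper semicontinuous functions on compact sets *)

Section semicontinuous_maxima.
Context {R : realType} {T : topologicalType}.
Implicit Types (K : set T) (A B h : T -> R).

(** Upper semicontinuity of the restriction of [h] to [K]. *)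
Definition usc_on K h :=
  forall p c, K p -> h p < c -> \forall p' \near p, K p' -> h p' < c.

Lemma usc_onD K A B : usc_on K A -> usc_on K B -> usc_on K (fun p => A p + B p).
Proof.
move=> uA uB p c Kp h.
have hA : A p < A p + (c - (A p + B p)) / 2 by lra.
have hB : B p < B p + (c - (A p + B p)) / 2 by lra.
near=> q => Kq.
have : A q < A p + (c - (A p + B p)) / 2 by move: Kq; near: q; exact: uA.
have : B q < B p + (c - (A p + B p)) / 2 by move: Kq; near: q; exact: uB.
by lra.
Unshelve. all: by end_near. Qed.

Lemma continuous_usc_on K h : continuous h -> usc_on K h.
Proof.
move=> ch p c _ hp; have := ch p; move/cvgr_lt => /(_ _ hp).
by apply: filterS.
Qed.

(** Without a maximum, the superlevel sets of [h] at its own values would generate a filter along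
    which every point of [K] is eventually exceeded, locally uniformly by semicontinuity.
    Compactness makes this uniform on [K], and some value would exceed itself. *)
Lemma usc_on_max K h : compact K -> K !=set0 -> usc_on K h ->
  exists2 p, K p & forall q, K q -> h q <= h p.
Proof.
move=> /compact_near_coveringP/near_covering_withinP cK [x0 Kx0] uh.
apply: contrapT => nomax.
have gt p : K p -> exists2 q, K q & h p < h q.
  move=> Kp; apply: contrapT => no; apply: nomax; exists p => // q Kq.
  by rewrite leNgt; apply/negP => hpq; apply: no; exists q.
pose F := filter_from K (fun y0 => [set y | K y /\ h y0 <= h y]).
have FF : Filter F.
  apply: filter_from_filter; first by exists x0.
  move=> i j Ki Kj; have [hij|/ltW hji] := leP (h i) (h j).
    by exists j => // y [Ky hy]; split; split=> //; exact: le_trans hy.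
  by exists i => // y [Ky hy]; split; split=> //; exact: le_trans hy.
have [] := cK T F (fun y x => h x < h y) FF.
  move=> x Kx; have [y Ky xy] := gt x Kx.
  exists ([set x' | K x' -> h x' < h y], [set y' | K y' /\ h y <= h y']) => /=.
    by split; [exact: uh|exists y].
  by move=> [x' y'] /= [h1 [_ h2]] Kx'; apply: lt_le_trans h2; exact: h1.
move=> y Ky /(_ y) h1; have := h1 (conj Ky (lexx _)) y Ky.
by rewrite ltxx.
Qed.

End semicontinuous_maxima.

(** * Doubling of variables *)

Section doubling_of_variables.
Context {R : realType} {T : topologicalType}.
Variables (K : set T) (A B : T -> R) (D : T * T -> R).
Hypotheses (cK : compact K) (uA : usc_on K A) (uB : usc_on K B).
Hypotheses (cD : continuous D) (D_ge0 : forall x, 0 <= D x).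
Hypotheses (Dxx : forall p, D (p, p) = 0) (D_eq0 : forall p q, D (p, q) = 0 -> p = q).

Let Phi (N : R) (x : T * T) : R := A x.1 + B x.2 - N * D x.

Let usc_Phi N : usc_on (K `*` K) (Phi N).
Proof.
apply: usc_onD; last first.
  by apply: continuous_usc_on => x; apply: cvgN; apply: cvgM; [exact: cvg_cst|exact: cD].
apply: usc_onD => -[p q] c [/= Kp Kq] h.
  exists ([set x | K x -> A x < c], setT) => /=.
    by split; [exact: uA|exact: filterT].
  by move=> [x y] /= [h1 _] [Kx _]; exact: h1.
exists (setT, [set x | K x -> B x < c]) => /=.
  by split; [exact: filterT|exact: uB].
by move=> [x y] /= [_ h1] [_ Ky]; exact: h1.
Qed.

(** Compactness of [K * K] reduces this to a neighbourhood of each pair. Off the diagonal a large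
    [N] pushes the value below [c]; on the diagonal either the sum stays below [c] nearby by
    semicontinuity, or [S] is a neighbourhood of the point. *)
Let near_diagonal (c : R) (S : set T) :
  (forall p, K p -> c <= A p + B p -> nbhs p S) ->
  \forall N \near +oo, forall p q, K p -> K q ->
    c <= A p + B q - N * D (p, q) -> S p /\ S q.
Proof.
move=> hS.
have /compact_near_coveringP/near_covering_withinP cKK : compact (K `*` K).
  exact: compact_setX.
have H : \forall N \near +oo, K `*` K `<=` (fun x => c <= Phi N x -> S x.1 /\ S x.2).
  apply: cKK => [[p q]] [/= Kp Kq].
  have [pq|pq] := pselect (p = q).
    subst q; have [h|h] := leP c (A p + B p).
      have nS := hS p Kp h.
      exists ([set x | S x.1 /\ S x.2], setT) => /=; last by move=> [x N] /= [].
      by split; [exists (S, S)|exact: filterT].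
    have hA : A p < A p + (c - (A p + B p)) / 2 by lra.
    have hB : B p < B p + (c - (A p + B p)) / 2 by lra.
    exists ([set x | (K x.1 -> A x.1 < A p + (c - (A p + B p)) / 2) /\
                     (K x.2 -> B x.2 < B p + (c - (A p + B p)) / 2)], [set N | 0 < N]) => /=.
      split; last exact: (nbhs_pinfty_gt (num_real _)).
      exists ([set x | K x -> A x < A p + (c - (A p + B p)) / 2],
              [set x | K x -> B x < B p + (c - (A p + B p)) / 2]) => //=.
      by split; [exact: uA|exact: uB].
    move=> [x N] /= [[h1 h2] N0] [K1 K2]; rewrite /Phi => h3; exfalso.
    have := h1 K1; have := h2 K2; have := mulr_ge0 (ltW N0) (D_ge0 x); lra.
  have D0 : 0 < D (p, q).
    by rewrite lt_def D_ge0 andbT; apply/eqP => /D_eq0.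
  set d := D (p, q) / 2; have d0 : 0 < d by rewrite divr_gt0.
  (* Beyond this threshold the penalty exceeds [A p + B q + 2 - c], the 2 being what [A] and [B] may
     gain near the pair. *)
  exists ([set x | [/\ K x.1 -> A x.1 < A p + 1, K x.2 -> B x.2 < B q + 1 & d < D x]],
          [set N | (`|A p + B q + 2 - c| / d) < N]) => /=.
    split; last exact: (nbhs_pinfty_gt (num_real _)).
    have n1 : \forall x \near (p, q), d < D x.
      have /cvgr_gt := @cD (p, q); apply; rewrite /d; lra.
    have n2 : \forall x \near (p, q), (K x.1 -> A x.1 < A p + 1) /\ (K x.2 -> B x.2 < B q + 1).
      exists ([set x | K x -> A x < A p + 1], [set x | K x -> B x < B q + 1]) => //=.
      by split; [apply: uA => //; lra|apply: uB => //; lra].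
    by apply: filterS2 n1 n2 => x ? [].
  move=> [x N] /= [[h1 h2 h3]]; rewrite ltr_pdivrMr// => h4 [K1 K2]; rewrite /Phi => h5.
  exfalso; have := h1 K1; have := h2 K2.
  have N0 : 0 <= N.
    have := le_lt_trans (normr_ge0 _) h4; rewrite pmulr_lgt0//; exact: ltW.
  have := ler_wpM2l N0 (ltW h3); have := ler_norm (A p + B q + 2 - c); lra.
by apply: filterS H => N h p q Kp Kq h1; exact: (h (p, q)).
Qed.

(** The maximal values are bounded below by the value at [(x0, x0)], so some [N] comes within e / 2
    of their infimum. At a maximizer for [2 * N], halving the penalty raises the value by
    [N * D (p, q)], which is thus at most e / 2. *)
Lemma penalized_maxima (x0 : T) (S : set T) (e : R) : K x0 -> 0 < e ->
  (forall p, K p -> A x0 + B x0 <= A p + B p -> nbhs p S) ->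
  exists N p q, [/\ 0 < N, K p /\ S p, K q /\ S q, N * D (p, q) <= e &
    forall p' q', K p' -> K q' ->
      A p' + B q' - N * D (p', q') <= A p + B q - N * D (p, q)].
Proof.
move=> Kx0 e0 hS.
have [N1 [_ hN1]] := near_diagonal hS.
have maxN N : exists x, (K `*` K) x /\ forall y, (K `*` K) y -> Phi N y <= Phi N x.
  have [|x ? ?] := usc_on_max (compact_setX cK cK) _ (@usc_Phi N); last by exists x.
  by exists (x0, x0).
have [f hf] := choice maxN.
pose v N := Phi N (f N).
have v_ge N : A x0 + B x0 <= v N.
  by have [_ /(_ (x0, x0))] := hf N; rewrite /Phi /= Dxx mulr0 subr0; apply.
pose N2 := Num.max N1 1.
pose E := [set v N | N in [set N | N2 < N]].
have E_inf : has_inf E.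
  split; first by exists (v (N2 + 1)), (N2 + 1) => //=; lra.
  by exists (A x0 + B x0) => _ [N _ <-].
have [_ [N /= N2N <-] hN] := inf_adherent (divr_gt0 e0 (ltr0n R 2)) E_inf.
have [N1N N_gt1] : N1 < N /\ 1 < N by move: N2N; rewrite gt_max => /andP[].
have vN : inf E <= v (2 * N).
  apply: ge_inf; first by case: E_inf.
  by exists (2 * N) => //=; lra.
have [[Kp Kq] hmax] := hf (2 * N).
have v2N := v_ge (2 * N).
move: Kp Kq hmax v2N vN; rewrite /v; case: (f (2 * N)) => p q /= Kp Kq hmax v2N vN.
have [Sp Sq] := hN1 (2 * N) ltac:(lra) p q Kp Kq v2N.
exists (2 * N), p, q; split=> //; first lra.
  have [_ /(_ (p, q) (conj Kp Kq))] := hf N.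
  move: hN vN; rewrite /v /Phi /=; lra.
by move=> p' q' Kp' Kq'; exact: (hmax (p', q')).
Qed.

End doubling_of_variables.

(** * A flattening of the unknown *)

Section flattening.
Context {R : realType}.

(* The G-equation is geometric, so it is preserved when the unknown is composed
   with the inverse of s + e^s - 1, which grows logarithmically at +oo and
   linearly at -oo. *)
Definition steepen (s : R) := s + expR s - 1.

Lemma ltr_steepen : {mono steepen : x y / x < y}.
Proof.
apply: leW_mono; apply: le_mono => x y xy; rewrite /steepen.
by have := ltr_expR x y; rewrite xy; lra.
Qed.

Lemma steepen_onto (s : R) : exists x, steepen x = s.
Proof.
have c a b : {within `[a, b], continuous steepen}.
  apply: continuous_subspaceT => x; apply: cvgB; last exact: cvg_cst.
  by apply: cvgD; [exact: cvg_id|exact: continuous_expR].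
have e0 : steepen 0 = 0 by rewrite /steepen expR0; lra.
have [s0|s0] := leP 0 s.
  have [|x _ <-] := IVT s0 (c 0 s) (v := s); last by exists x.
  rewrite ge_min le_max e0 s0 /=; apply/orP; right.
  by rewrite /steepen; have := expR_ge1Dx s; lra.
have [|x _ <-] := IVT (ltW s0) (c s 0) (v := s); last by exists x.
rewrite ge_min le_max e0 (ltW s0) orbT andbT; apply/orP; left.
by rewrite /steepen; have := ltr_expR s 0; rewrite s0 expR0; lra.
Qed.

(** The inverse of [steepen]; by [steepen_onto] the default 0 is never resorted to. *)
Definition flatten (s : R) : R := xget 0 [set x | steepen x = s].

Lemma flattenK s : steepen (flatten s) = s.
Proof. exact: (xgetPex 0 (steepen_onto s)). Qed.

Lemma flatten_lt s c : (flatten s < c) = (s < steepen c).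
Proof. by rewrite -ltr_steepen flattenK. Qed.

Lemma flatten_le s c : (flatten s <= c) = (s <= steepen c).
Proof. by rewrite !leNgt -ltr_steepen flattenK. Qed.

Lemma flatten_homo x y : x <= y -> flatten x <= flatten y.
Proof. by rewrite flatten_le flattenK. Qed.

Lemma flatten_gt0 s : (0 < flatten s) = (0 < s).
Proof. by rewrite -ltr_steepen flattenK /steepen expR0 add0r subrr. Qed.

(** Under a large scaling [k], the linear decay at -oo beats the logarithmic growth at +oo, however
    small [dl] is compared with [M]. *)
Lemma flatten_unbalanced (M dl : R) : 0 < M -> 0 < dl ->
  exists2 k, 0 < k & flatten (k * M) + flatten (- (k * dl)) <= 0.
Proof.
move=> M0 dl0.
have Mdl : 0 < M / dl by rewrite divr_gt0.
(* As [k * dl = y + 1], the flattening of [- (k * dl)] is below [- y]. For this [y], the bound e^y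
   >= 1 + y^2 / 2 gives [steepen y >= k * M], so the flattening of [k * M] is at most [y]. *)
set y := 1 + 8 * (M / dl); set k := (y + 1) / dl.
have k0 : 0 < k by rewrite divr_gt0// /y; lra.
exists k => //.
have kdl : k * dl = y + 1 by rewrite /k divfK// gt_eqF.
set x := flatten (- (k * dl)).
suff : flatten (k * M) <= - x by lra.
have hx : x + expR x - 1 = - (y + 1) by rewrite -kdl; exact: flattenK.
have yx : y <= - x by have := expR_gt0 x; lra.
rewrite flatten_le; apply: (@le_trans _ _ (steepen y)); last first.
  by rewrite leNgt ltr_steepen -leNgt.
have y0 : 0 <= y by rewrite /y; lra.
have := expR_ge1Dxn 1 y0; rewrite /steepen (_ : 2`! = 2)//.
have -> : k * M = (y + 1) * (M / dl) by rewrite /k mulrAC mulrA.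
by rewrite /y; set a := M / dl in Mdl *; nra.
Qed.

Lemma C1_steepen {V : normedModType R} (phi : V -> R) dphi : C1 phi dphi ->
  C1 (fun z => steepen (phi z)) (fun z v => (1 + expR (phi z)) * dphi z v).
Proof.
move=> h; apply: (@C1_comp _ _ steepen (fun s => 1 + expR s) _ _ h) => z.
  rewrite -[X in is_derive _ _ _ X]subr0.
  exact: (is_deriveB (is_deriveD (is_derive_id (phi z) 1) (is_derive_expR (phi z)))
    (is_derive_cst (1 : R) (phi z) 1)).
by apply: cvgD; [exact: cvg_cst|exact: continuous_expR].
Qed.

End flattening.

(** * Compactness of Euclidean balls *)

Section compact_sets.
Context {R : realType} {n : nat}.
Implicit Types z : euclid R n.

Lemma compact_enorm_ball z0 (r : R) : compact [set z | enorm (z - z0) <= r].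
Proof.
have cc : closed [set z : euclid R n | enorm (z - z0) <= r].
  apply: (@closed_comp _ _ (fun z => enorm (z - z0)) [set x | x <= r]).
    move=> z _; apply: (@continuous_comp _ _ _ (fun z => z - z0) (@enorm R n)).
      by apply: cvgB; [exact: cvg_id|exact: cvg_cst].
    exact: continuous_enorm.
  exact: closed_le.
apply: (subclosed_compact cc); first apply: compact_setX.
- apply: (@rV_compact _ _ (fun i => `[z0.1 0 i - r, z0.1 0 i + r]%classic)) => i.
  exact: segment_compact.
- exact: (@segment_compact _ (z0.2 - r) (z0.2 + r)).
move=> z /= zr; split.
  move=> i /=; rewrite in_itv /=.
  by have := le_trans (normr_coord_le (z - z0) i) zr; rewrite !mxE ler_norml; lra.
rewrite /= in_itv /=.
by have := le_trans (normr_height_le (z - z0)) zr; rewrite ler_norml /=; lra.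
Qed.

End compact_sets.

(** * Comparison principle with separated initial signs *)

Section comparison.
Context {R : realType} {n : nat}.
Variable b : spacetime R n -> euclid R n.
Implicit Types (g : spacetime R n -> R) (p q : spacetime R n).

Definition time_gradient (dphi : spacetime R n -> spacetime R n -> R) p :=
  gradient (fun v => dphi p (v, 0)).

(* Sub- and supersolutions of g_t + b . Dg + |Dg| = 0, the latter expressed
   through - g, so that both are tested from above. *)
Definition test_sub g := forall phi dphi p, C1 phi dphi -> 0 < p.2 ->
  (\forall p' \near p, g p' - phi p' <= g p - phi p) ->
  dphi p (0, 1) + dotp (b p) (time_gradient dphi p)
    + enorm (time_gradient dphi p) <= 0.

Definition test_opp_super g := forall phi dphi p, C1 phi dphi -> 0 < p.2 ->
  (\forall p' \near p, g p' - phi p' <= g p - phi p) ->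
  dphi p (0, 1) + dotp (b p) (time_gradient dphi p)
    - enorm (time_gradient dphi p) <= 0.

Lemma C1_sqr_dist_st q :
  C1 (fun p => dotp (p.1 - q.1) (p.1 - q.1) + (p.2 - q.2) ^+ 2)
     (fun p v => dotp (2 *: (p.1 - q.1)) v.1 + 2 * (p.2 - q.2) * v.2).
Proof.
have h1 : C1 (fun p : spacetime R n => dotp (p.1 - q.1) (p.1 - q.1))
             (fun p v => 2 * dotp (p.1 - q.1) v.1).
  apply: (C1_precomp (l := fst) _ _ (C1_sqr_dist q.1)) => //.
  by move=> z; exact: cvg_fst.
have h2 : C1 (fun p : spacetime R n => p.2) (fun _ v => v.2).
  by apply: C1_linear => // z; exact: cvg_snd.
have h3 := C1D h2 (C1_cst (- q.2)).
by apply: C1_eq (C1D h1 (C1M h3 h3)) _ => p v; rewrite dotpZl; ring.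
Qed.

(** The time derivative is twice the function, while the gradient is at most the function in norm,
    since 2 r <= 1 + r^2. This leaves room for any speed of propagation below 2. *)
Lemma C1_speed_cone z0 :
  C1 (fun p : spacetime R n => expR (2 * p.2) * (1 + dotp (p.1 - z0) (p.1 - z0)))
     (fun p v => dotp ((2 * expR (2 * p.2)) *: (p.1 - z0)) v.1 +
        2 * (expR (2 * p.2) * (1 + dotp (p.1 - z0) (p.1 - z0))) * v.2).
Proof.
have h1 : C1 (fun p : spacetime R n => dotp (p.1 - z0) (p.1 - z0))
             (fun p v => 2 * dotp (p.1 - z0) v.1).
  apply: (C1_precomp (l := fst) _ _ (C1_sqr_dist z0)) => //.
  by move=> z; exact: cvg_fst.
have h2 : C1 (fun p : spacetime R n => p.2) (fun _ v => v.2).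
  by apply: C1_linear => // z; exact: cvg_snd.
have h3 : C1 (fun p : spacetime R n => expR (2 * p.2))
             (fun p v => expR (2 * p.2) * (2 * v.2)).
  apply: (C1_comp (h := expR) (h' := expR) (C1Z 2 h2)) => p.
  exact: continuous_expR.
apply: C1_eq (C1M h3 (C1D (C1_cst 1) h1)) _ => p v; rewrite dotpZl; ring.
Qed.

Section flattened_test.
Variables (g phi : spacetime R n -> R) (dphi : spacetime R n -> spacetime R n -> R).
Variables (k s : R) (p : spacetime R n) (X : euclid R n).
Hypotheses (k_gt0 : 0 < k) (C1phi : C1 phi dphi) (p_gt0 : 0 < p.2).
Hypothesis dphiE : forall v, dphi p v = dotp X v.1 + s * v.2.
Hypothesis touch : \forall p' \near p, flatten (k * g p') <= phi p'.
Hypothesis touch_eq : flatten (k * g p) = phi p.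

(** When [phi] touches the flattened [g] from above, [psi] touches [g]. The differential of [psi] at
    [p] is [r] times that of [phi], and this positive factor drops out because the operator is
    homogeneous of degree one. *)
Let r := k^-1 * (1 + expR (phi p)).
Let r_gt0 : 0 < r.
Proof. by rewrite mulr_gt0 ?invr_gt0// addr_gt0// expR_gt0. Qed.

Let psi p' := k^-1 * steepen (phi p').
Let dpsi p' v := k^-1 * ((1 + expR (phi p')) * dphi p' v).

Let C1psi : C1 psi dpsi. Proof. exact: C1Z (C1_steepen C1phi). Qed.

Let psi_touch : \forall p' \near p, g p' - psi p' <= g p - psi p.
Proof.
have -> : g p - psi p = 0.
  by rewrite /psi -touch_eq flattenK mulKf ?subrr ?gt_eqF.
apply: filterS touch => p'; rewrite flatten_le => h.
by rewrite subr_le0 /psi ler_pdivlMl.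
Qed.

Let dpsi_time : dpsi p (0, 1) = r * s.
Proof.
rewrite /dpsi dphiE /= mulr1 mulrA.
by rewrite (_ : dotp X 0 = 0) ?add0r// -(scale0r 0) dotpZr mul0r.
Qed.

Let dpsi_space : time_gradient dpsi p = r *: X.
Proof.
rewrite /time_gradient (_ : (fun v => _) = dotp (r *: X)) ?gradient_dotp//.
by apply/funext => v; rewrite /dpsi dphiE /= mulr0 addr0 dotpZl mulrA.
Qed.

Lemma flattened_test_sub : test_sub g -> s + dotp (b p) X + enorm X <= 0.
Proof.
move=> /(_ _ _ _ C1psi p_gt0 psi_touch).
rewrite dpsi_time dpsi_space dotpZr enormZ gtr0_norm// -!mulrDr.
by rewrite pmulr_rle0.
Qed.

Lemma flattened_test_opp_super :
  test_opp_super g -> s + dotp (b p) X - enorm X <= 0.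
Proof.
move=> /(_ _ _ _ C1psi p_gt0 psi_touch).
rewrite dpsi_time dpsi_space dotpZr enormZ gtr0_norm// -mulrDr -mulrBr.
by rewrite pmulr_rle0.
Qed.

End flattened_test.

(** If both values were positive at [(z0, t0)], the penalized sum of the flattened functions would
    have its doubled maxima away from t = 0, by [init] and the choice of [k], and away from the edge
    of [K], by the growth of [pen]. There the two tests contradict the speed bound. *)
Lemma comparison (L : R) (g1 g2 : spacetime R n -> R) (dl : R) :
  (forall p a, 0 < p.2 -> `|dotp (b p) a| <= 100^-1 * enorm a) ->
  (forall p q a, 0 < p.2 -> 0 < q.2 -> `|dotp (b p - b q) a| <=
     L * (enorm (p.1 - q.1) + `|p.2 - q.2|) * enorm a) ->
  usc_on nonneg_time g1 -> usc_on nonneg_time g2 ->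
  test_sub g1 -> test_opp_super g2 -> 0 < dl ->
  (forall z, g1 (z, 0) <= - dl \/ g2 (z, 0) <= - dl) ->
  forall p, 0 < p.2 -> 0 < g1 p -> g2 p <= 0.
Proof.
move=> b_le b_lip usc1 usc2 sub1 super2 dl0 init [z0 t0] /= t0_gt0 g1_gt0.
rewrite leNgt; apply/negP => g2_gt0.
pose cone (p : spacetime R n) := expR (2 * p.2) * (1 + dotp (p.1 - z0) (p.1 - z0)).
have C1cone : C1 cone _ := C1_speed_cone z0.
(* The compact set [K] is a sublevel set of [cone] slightly larger than the one through
   [(z0, t0)]. *)
pose q0 := cone (z0, t0); pose Q := q0 + 1.
have cone_ge1 p : 0 <= p.2 -> 1 <= cone p.
  move=> p2; have := dotpp_ge0 (p.1 - z0).
  have : 1 <= expR (2 * p.2) by have := expR_ge1Dx (2 * p.2); lra.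
  by rewrite /cone; set a := expR _; set c := dotp _ _; nra.
have q0_ge1 : 1 <= q0 by apply: cone_ge1; exact: ltW.
pose K := [set p | nonneg_time p /\ cone p <= Q].
have cK : compact K.
  have clK : closed K.
    apply: closedI.
      apply: (@closed_comp _ _ snd [set x : R | 0 <= x]); last exact: closed_ge.
      by move=> p _; exact: cvg_snd.
    apply: (@closed_comp _ _ cone [set x : R | x <= Q]); last exact: closed_le.
    by move=> p _; exact: (C1_continuous C1cone).
  apply: (subclosed_compact clK (compact_setX (@compact_enorm_ball R n z0 Q)
    (@segment_compact R 0 Q))) => -[z t] [/= t_ge0 hQ].
  have := dotpp_ge0 (z - z0); rewrite -sqr_enorm in hQ *.
  move: hQ; rewrite /cone /= -sqr_enorm.
  have := expR_ge1Dx (2 * t); have := enorm_ge0 (z - z0).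
  rewrite /nonneg_time /= in t_ge0.
  set a := expR _; set e := enorm _ => e0 a1 hQ e2.
  split; rewrite /= ?in_itv/=; last by nra.
  have : 1 + e ^+ 2 <= Q by nra.
  by nra.
have K0 : K (z0, t0).
  by split; rewrite /= /nonneg_time /=; [exact: ltW|rewrite /Q -/q0; lra].
have KT : K `<=` nonneg_time by move=> p [].
have uscK g : usc_on nonneg_time g -> usc_on K g.
  move=> ug p c Kp gc; apply: filterS (ug p c (KT _ Kp) gc) => p' h Kp'.
  by apply: h; exact: KT.
have bounded g : usc_on nonneg_time g -> exists M, forall p, K p -> g p <= M.
  move=> ug; have [|p _ hp] := usc_on_max cK _ (uscK _ ug); first by exists (z0, t0).
  by exists (g p).
have [M1 hM1] := bounded _ usc1; have [M2 hM2] := bounded _ usc2.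
pose M := Num.max 1 (Num.max M1 M2).
have M0 : 0 < M by rewrite lt_max ltr01.
have gM p : K p -> g1 p <= M /\ g2 p <= M.
  by move=> Kp; rewrite !le_max (hM1 p Kp) (hM2 p Kp) !orbT.
have [k k0 hk] := flatten_unbalanced M0 dl0.
(* Half of the sum is spent on the penalization, which equals [c] at [(z0, t0)]; the other half
   keeps [A + B = c] positive there. *)
pose c := (flatten (k * g1 (z0, t0)) + flatten (k * g2 (z0, t0))) / 2.
have c0 : 0 < c.
  by rewrite divr_gt0// addr_gt0// flatten_gt0 mulr_gt0.
pose FM := flatten (k * M).
have FM0 : 0 < FM by rewrite flatten_gt0 mulr_gt0.
have Fg p : K p -> flatten (k * g1 p) <= FM /\ flatten (k * g2 p) <= FM.
  by move=> /gM[? ?]; split; apply: flatten_homo; rewrite ler_pM2l.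
(* Where [cone = Q], the penalization is then at least [c * (1 + m) = c + 2 * FM], more than the
   flattened values can compensate. *)
pose m := 2 * FM / c.
have m0 : 0 < m by rewrite divr_gt0// mulr_gt0.
pose pen p := c * expR (m * (cone p - q0)).
have C1pen : C1 pen (fun p v => c * (expR (m * (cone p - q0)) *
    (m * (dotp ((2 * expR (2 * p.2)) *: (p.1 - z0)) v.1 + 2 * cone p * v.2 + 0)))).
  apply: C1Z; apply: (C1_comp (h := expR) (h' := expR)
    (C1Z m (C1D C1cone (C1_cst (- q0))))) => p; exact: continuous_expR.
pose A p := flatten (k * g1 p) - pen p; pose B p := flatten (k * g2 p).
have usc_flatten g : usc_on nonneg_time g -> usc_on K (fun p => flatten (k * g p)).
  move=> ug p a Kp; rewrite flatten_lt -ltr_pdivlMl// => h.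
  by apply: filterS (uscK _ ug p _ Kp h) => p' h' /h'; rewrite flatten_lt -ltr_pdivlMl.
have uA : usc_on K A.
  apply: usc_onD; first exact: usc_flatten.
  by apply: continuous_usc_on => p; apply: cvgN; exact: (C1_continuous C1pen).
have uB : usc_on K B by exact: usc_flatten.
pose D (x : spacetime R n * spacetime R n) :=
  dotp (x.1.1 - x.2.1) (x.1.1 - x.2.1) + (x.1.2 - x.2.2) ^+ 2.
have cD : continuous D.
  have -> : D = (fun p => dotp p.1 p.1 + p.2 ^+ 2) \o (fun x => x.1 - x.2) by [].
  move=> x; apply: continuous_comp.
    by apply: cvgB; [exact: cvg_fst|exact: cvg_snd].
  have := C1_continuous (C1_sqr_dist_st 0) => /(_ (x.1 - x.2)).
  by under eq_fun do rewrite !subr0.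
have D_ge0 x : 0 <= D x by rewrite addr_ge0 ?dotpp_ge0 ?sqr_ge0.
have Dxx p : D (p, p) = 0.
  by rewrite /D /= !subrr expr0n addr0 -(scale0r 0) dotpZr mul0r.
have D_eq0 p q : D (p, q) = 0 -> p = q.
  rewrite /D /= => /eqP; rewrite paddr_eq0 ?dotpp_ge0 ?sqr_ge0// sqrf_eq0 subr_eq0.
  rewrite -sqr_enorm sqrf_eq0 => /andP[/eqP/enorm_eq0/eqP]; rewrite subr_eq0.
  by case: p q => [? ?] [? ?] /= /eqP-> /eqP->.
pose S := [set p : spacetime R n | 0 < p.2 /\ cone p < Q].
have openS p : S p -> nbhs p S.
  move=> [p2 hp]; apply: filterI.
    have c2 : (snd p') @[p' --> p] --> p.2 by exact: cvg_snd.
    by move/cvgr_gt : c2 => /(_ _ p2).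
  by have /cvgr_lt := @C1_continuous _ _ _ _ C1cone p => /(_ _ hp).
have AB0 : A (z0, t0) + B (z0, t0) = c.
  rewrite /A /B /pen -/q0 subrr mulr0 expR0 mulr1 /c; lra.
have hS p : K p -> A (z0, t0) + B (z0, t0) <= A p + B p -> nbhs p S.
  move=> Kp; rewrite AB0 /A /B => h; apply: openS.
  have [Fg1 Fg2] := Fg p Kp; have [p_ge0 p_le] := Kp; split.
    rewrite lt_def [X in _ && X]p_ge0 andbT; apply/eqP => p20.
    have pen0 : 0 < pen p by rewrite mulr_gt0// expR_gt0.
    (* At t = 0 one flattened value is at most [flatten (- (k * dl))] and the other at most [FM]; by
       [hk] their sum is not positive. *)
    have [] := init p.1; rewrite -p20 -surjective_pairing => gdl.
      have : flatten (k * g1 p) <= flatten (- (k * dl)).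
        by apply: flatten_homo; rewrite -mulrN ler_pM2l.
      by move: hk; rewrite -/FM; lra.
    have : flatten (k * g2 p) <= flatten (- (k * dl)).
      by apply: flatten_homo; rewrite -mulrN ler_pM2l.
    by move: hk; rewrite -/FM; lra.
  rewrite lt_neqAle p_le andbT; apply/eqP => pQ.
  have : c * (1 + m) <= pen p.
    rewrite /pen ler_pM2l// pQ /Q addrAC subrr add0r mulr1; exact: expR_ge1Dx.
  have -> : c * (1 + m) = c + 2 * FM by rewrite /m mulrDr mulr1 mulrCA divff ?mulr1// gt_eqF.
  lra.
(* A lower bound, uniform in [p], for the factor [lam] by which the differential of [pen] multiplies
   that of [cone]. *)
pose eta := c * m * expR (- (m * q0)).
have eta0 : 0 < eta by rewrite mulr_gt0 ?expR_gt0// mulr_gt0.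
pose L' := Num.max L 0.
have L'0 : 0 <= L' by rewrite le_max lexx orbT.
have e0 : 0 < eta / (8 * L' + 8) by rewrite divr_gt0//; lra.
have [N [p [q [N0 [Kp Sp] [Kq Sq] ND hmax]]]] :=
  penalized_maxima cK uA uB cD D_ge0 Dxx D_eq0 K0 e0 hS.
have [p2 _] := Sp; have [q2 _] := Sq.
have SK p' : S p' -> K p' by move=> [? ?]; split; exact: ltW.
set dz := p.1 - q.1; set dt := p.2 - q.2.
set lam := c * m * expR (m * (cone p - q0)).
have lam_ge : eta <= lam.
  rewrite /eta /lam ler_pM2l; last by rewrite mulr_gt0.
  rewrite ler_expR mulrBr lerBrDr addrC subrr.
  by rewrite mulr_ge0 ?(ltW m0)// (le_trans ler01)// cone_ge1// ltW.
have lam0 : 0 < lam by exact: lt_le_trans lam_ge.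
pose X := (2 * N) *: dz; pose Y := (lam * (2 * expR (2 * p.2))) *: (p.1 - z0).
have sub : 2 * N * dt + lam * (2 * cone p) + dotp (b p) (X + Y) + enorm (X + Y) <= 0.
  (* Flattening does not commute with adding constants, so [C] is needed for contact with
     equality. *)
  pose C := A p - N * D (p, q).
  have C1phi := C1D (C1D (C1Z N (C1_sqr_dist_st q)) C1pen) (C1_cst C).
  apply: (flattened_test_sub k0 C1phi p2 _ _ _ sub1).
  - move=> v; rewrite /X /Y /dz /dt dotpDl !dotpZl /lam; ring.
  - apply: filterS (openS p Sp) => p' /SK Kp'.
    have := hmax p' q Kp' Kq; rewrite /C /A /D /=; lra.
  - by rewrite /C /A /D /=; lra.
have super : 2 * N * - dt + dotp (b q) (- X) - enorm (- X) <= 0.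
  pose C := B q - N * D (p, q).
  have C1phi := C1D (C1Z N (C1_sqr_dist_st p)) (C1_cst C).
  apply: (flattened_test_opp_super k0 C1phi q2 _ _ _ super2).
  - move=> v; rewrite /X /dz -scalerN opprB !dotpZl /dt; ring.
  - apply: filterS (openS q Sq) => q' /SK Kq'.
    have := hmax p q' Kp Kq'.
    rewrite /C /B /D /= (sqr_distC p.1 q'.1).
    have -> : (p.2 - q'.2) ^+ 2 = (q'.2 - p.2) ^+ 2 by ring.
    by lra.
  - rewrite /C /B /D /= (sqr_distC p.1 q.1); lra.
have Y_le : enorm Y <= lam * cone p.
  rewrite /Y enormZ ger0_norm; last first.
    by apply: mulr_ge0; [exact: ltW|rewrite mulr_ge0// expR_ge0].
  rewrite -mulrA ler_pM2l// /cone -sqr_enorm.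
  have := expR_gt0 (2 * p.2); set a := expR _; set e := enorm _ => a0.
  by have := sqr_ge0 (1 - e); nra.
have bY : - (100^-1 * enorm Y) <= dotp (b p) Y.
  by have := b_le p Y p2; rewrite ler_norml => /andP[].
have triY : enorm X - enorm Y <= enorm (X + Y).
  by have := enormD (X + Y) (- Y); rewrite addrK enormN; lra.
have bX : - (4 * L' * (N * D (p, q))) <= dotp (b p - b q) X.
  have := b_lip p q X p2 q2; rewrite ler_norml => /andP[h _]; apply: le_trans h.
  rewrite lerN2 /X enormZ (@gtr0_norm _ (2 * N)) ?mulr_gt0// -/dz -/dt.
  have dz0 := enorm_ge0 dz; have dt0 := normr_ge0 dt.
  have hL : L * (enorm dz + `|dt|) <= L' * (enorm dz + `|dt|).
    by rewrite ler_wpM2r ?addr_ge0// le_max lexx.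
  have hD : (enorm dz + `|dt|) * enorm dz <= 2 * D (p, q).
    rewrite /D /= -/dz -/dt -sqr_enorm -[dt ^+ 2]real_normK ?num_real//.
    by have := sqr_ge0 (enorm dz - `|dt|); nra.
  apply: (@le_trans _ _ (L' * (enorm dz + `|dt|) * (2 * N * enorm dz))).
    by apply: ler_wpM2r hL; rewrite mulr_ge0// mulr_ge0// ltW.
  have -> : L' * (enorm dz + `|dt|) * (2 * N * enorm dz) =
    (2 * L' * N) * ((enorm dz + `|dt|) * enorm dz) by ring.
  have -> : 4 * L' * (N * D (p, q)) = (2 * L' * N) * (2 * D (p, q)) by ring.
  by rewrite ler_wpM2l// !mulr_ge0// ltW.
have LND : 4 * L' * (N * D (p, q)) <= eta / 2.
  apply: (@le_trans _ _ (4 * L' * (eta / (8 * L' + 8)))).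
    by rewrite ler_wpM2l// mulr_ge0.
  rewrite mulrA ler_pdivrMr; last by lra.
  by have := ltW eta0; nra.
have lc : lam <= lam * cone p by rewrite ler_peMr ?cone_ge1// ltW.
(* In the sum of [sub] and [super] the terms in [dt] cancel. What remains is at least
   [(2 - 101/100) * lam * cone p] minus the Lipschitz error, at most [eta / 2], hence positive. *)
move: sub super bX; rewrite dotpDr dotpNr enormN dotpBl.
move: Y_le bY triY LND lc lam_ge eta0; lra.
Qed.

End comparison.

(** * Semicontinuous envelopes *)

Lemma leeB_opp {R : realType} (x y : \bar R) (a b : R) :
  (x - a%:E <= y - b%:E -> - y - (- b)%R%:E <= - x - (- a)%R%:E)%E.
Proof.
by rewrite 2!EFinN 2!oppeK -!fin_num_oppeB// leeN2.
Qed.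

Section envelopes.
Context {R : realType} {T : normedModType R}.
Implicit Types (A : set T) (g : T -> R) (z : T).

Lemma usc_env_le A g z (c : R) :
  (\forall z' \near z, A z' -> g z' <= c) -> (usc_env A g z <= c%:E)%E.
Proof.
move=> h; rewrite /usc_env /limf_esup.
apply: (@le_trans _ _ (ereal_sup ((EFin \o g) @` [set z' | A z' /\ g z' <= c]))).
  apply: ereal_inf_lbound.
  exists [set z' | A z' /\ g z' <= c] => //.
  by apply: filterS h => z' h' Az'; split=> //; exact: h'.
by apply: ge_ereal_sup => _ [z' [_ gz'] <-]; rewrite lee_fin.
Qed.

Lemma usc_env_lt A g z (c : R) : (usc_env A g z < c%:E)%E ->
  \forall z' \near z, A z' -> g z' < c.
Proof.
move=> /ereal_inf_lt [_ [B hB <-] hc].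
apply: filterS hB => z' Bz'; rewrite -lte_fin; apply: le_lt_trans hc.
by apply: ereal_sup_ubound; exists z'.
Qed.

Lemma usc_env_ge A g z : A z -> ((g z)%:E <= usc_env A g z)%E.
Proof.
move=> Az; apply: le_ereal_inf_tmp => _ [B hB <-].
apply: ereal_sup_ubound; exists z => //.
by have := nbhs_singleton hB; apply.
Qed.

Lemma usc_env_interior A g z : nbhs z A -> usc_env A g z = usc_env setT g z.
Proof.
move=> nA; rewrite /usc_env; congr limf_esup.
apply/funext => B; apply/propext; rewrite /within /=; split.
  by apply: filterS2 nA => z' Az' h' _; exact: h'.
by apply: filterS => z' h' _; exact: h'.
Qed.

Lemma lsc_envE A g z : lsc_env A g z = (- usc_env A (\- g)%R z)%E.
Proof. by []. Qed.

Lemma locally_bounded_onN A g : locally_bounded_on A g -> locally_bounded_on A (\- g).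
Proof.
move=> h z /h [M hM]; exists M; apply: filterS hM => z'; by rewrite normrN.
Qed.

(** For a locally bounded [g] the envelope is finite at the points of [A], so the default value of
    [fine] does not occur there. *)
Definition usc_envR A g z : R := fine (usc_env A g z).

Lemma usc_envRE A g z : locally_bounded_on A g -> A z ->
  usc_env A g z = (usc_envR A g z)%:E.
Proof.
move=> bg Az; rewrite /usc_envR fineK// fin_numE.
have [M hM] := bg z Az.
have h1 : (usc_env A g z <= M%:E)%E.
  apply: usc_env_le; apply: filterS hM => z' h /h; apply: le_trans; exact: ler_norm.
have := usc_env_ge g Az; move: h1; by case: usc_env.
Qed.

Lemma usc_envR_ge A g z : locally_bounded_on A g -> A z -> g z <= usc_envR A g z.
Proof. by move=> bg Az; rewrite -lee_fin -usc_envRE// usc_env_ge. Qed.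

(** A bound of [g] near [z] holds near all nearby points, and so bounds the envelope there; the
    midpoint [c'] restores the strict inequality. *)
Lemma usc_envR_usc A g : locally_bounded_on A g -> usc_on A (usc_envR A g).
Proof.
move=> bg z c Az hc.
set c' := (usc_envR A g z + c) / 2.
have hc' : usc_envR A g z < c' by rewrite /c'; lra.
have c'c : c' < c by rewrite /c'; lra.
have := @usc_env_lt A g z c'; rewrite (usc_envRE bg Az) lte_fin => /(_ hc').
move/near_join; apply: filterS => z' hz' Az'; apply: le_lt_trans c'c.
rewrite -lee_fin -(usc_envRE bg Az'); apply: usc_env_le.
by apply: filterS hz' => y h /h /ltW.
Qed.

Lemma usc_env_continuous_le g f z : continuous f -> (forall z', g z' <= f z') ->
  (usc_env setT g z <= (f z)%:E)%E.
Proof.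
move=> cf gf; apply/lee_addgt0Pr => e e0; rewrite -EFinD.
apply: usc_env_le; have fz : f z < f z + e by rewrite ltrDl.
have /cvgr_lt := @cf z => /(_ _ fz); apply: filterS => z' h _.
exact: le_trans (gf z') (ltW h).
Qed.

Lemma usc_env_continuous g z : continuous g -> usc_env setT g z = (g z)%:E.
Proof.
by move=> cg; apply/eqP; rewrite eq_le usc_env_continuous_le// usc_env_ge.
Qed.

Lemma lsc_env_continuous g z : continuous g -> lsc_env setT g z = (g z)%:E.
Proof.
move=> cg; rewrite lsc_envE usc_env_continuous ?EFinN ?oppeK//.
by move=> z'; apply: cvgN; exact: cg.
Qed.

Lemma usc_onDr A g (c : R) : usc_on A g -> usc_on A (fun z => g z + c).
Proof. by move=> h; apply: usc_onD => //; apply: continuous_usc_on; exact: cst_continuous. Qed.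

End envelopes.

(** * Solutions of the G-equation as sub- and supersolutions *)

Section G_solution_tests.
Context {R : realType} {n : nat}.
Variables (eps : R) (alpha : \bar R) (u : spacetime R n -> euclid R n).

Definition drift (p : spacetime R n) := eps *: u (p.1, epow eps alpha * p.2).

Lemma near_positive_time (p : spacetime R n) : 0 < p.2 -> nbhs p positive_time.
Proof.
move=> p0; have c2 : (snd p') @[p' --> p] --> p.2 by exact: cvg_snd.
by move/cvgr_gt : c2 => /(_ _ p0).
Qed.

(** The equation is stated with the envelope over positive times, whereas comparison needs the one
    that also makes sense at t = 0. *)
Lemma usc_env_positive (g : spacetime R n -> R) (p : spacetime R n) : 0 < p.2 ->
  usc_env positive_time g p = usc_env nonneg_time g p.
Proof.
move=> /near_positive_time h; rewrite usc_env_interior// usc_env_interior//.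
by apply: filterS h => p' /ltW.
Qed.

Lemma near_usc_envR_touch (g : spacetime R n -> R) (phi : spacetime R n -> R)
    (c : R) (p : spacetime R n) :
  locally_bounded_on nonneg_time g -> 0 < p.2 ->
  (\forall p' \near p, usc_envR nonneg_time g p' + c - phi p' <=
                       usc_envR nonneg_time g p + c - phi p) ->
  \forall p' \near p, (usc_env positive_time g p' - (phi p')%:E <=
                       usc_env positive_time g p - (phi p)%:E)%E.
Proof.
move=> bg p0 h; apply: filterS2 (near_positive_time p0) h => p' p'0 h'.
rewrite !usc_env_positive// !usc_envRE//; last 2 first.
- exact: ltW.
- exact: ltW.
move: (usc_envR _ g p') (usc_envR _ g p) (phi p') (phi p) h' => x y x' y'.
by rewrite !(addrAC _ c) lerD2r.
Qed.

(** The operator sees only derivatives, hence the free constant [c]; it will produce the gap at t =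
    0 that [comparison] asks for. *)
Lemma G_test_sub g G c : G_solution eps alpha u g G ->
  test_sub drift (fun p => usc_envR nonneg_time G p + c).
Proof.
move=> [[_ subG _] bG _ _] phi dphi p C1phi p0 touch.
have := subG phi p p0 (C1_Ck_on _ C1phi) (near_usc_envR_touch bG p0 touch).
have -> : (fun v => 'D_v phi p) = dphi p.
  by apply/funext => v; exact: C1_derive C1phi.
by rewrite /G_operator /drift dotpZl.
Qed.

Lemma G_test_opp_super g G c : G_solution eps alpha u g G ->
  test_opp_super drift (fun p => usc_envR nonneg_time (\- G) p + c).
Proof.
move=> [[_ _ superG] bG _ _] phi dphi p C1phi p0 touch.
(* Touching [- G] from above by [phi] amounts to touching [G] from below by [- phi]. *)
have C1N := C1Z (-1) C1phi.
have touchN := near_usc_envR_touch (locally_bounded_onN bG) p0 touch.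
have := superG _ p p0 (C1_Ck_on _ C1N).
have -> : (fun v => 'D_v (fun z => -1 * phi z) p) = (fun v => -1 * dphi p v).
  by apply/funext => v; exact: C1_derive C1N.
have h : \forall p' \near p, (lsc_env positive_time G p - (-1 * phi p)%:E <=
                            lsc_env positive_time G p' - (-1 * phi p')%:E)%E.
  by apply: filterS touchN => p'; rewrite !mulN1r; exact: leeB_opp.
move=> /(_ h); rewrite /G_operator /drift dotpZl.
have -> : gradient (fun v => -1 * dphi p (v, 0)) = - time_gradient dphi p.
  rewrite /time_gradient /gradient; congr (_, _); last by rewrite mulN1r.
  by apply/rowP => i; rewrite !mxE mulN1r.
by rewrite dotpNr enormN mulN1r; lra.
Qed.

End G_solution_tests.

(** * Lipschitz bounds from bounded derivatives *)

Section mean_value_bound.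
Context {R : realType} {n : nat}.
Implicit Types (u : spacetime R n -> euclid R n) (p q v : spacetime R n).

Lemma st_basis v :
  v = \sum_(i < n.-1) v.1.1 0 i *: ((xdir i, 0) : spacetime R n) +
      v.1.2 *: (ydir, 0) + v.2 *: (0, 1).
Proof.
have sumE (I : finType) (F : I -> euclid R n) :
    \sum_i ((F i, 0) : spacetime R n) = (\sum_i F i, 0).
  by elim/big_rec2 : _ => // i y x _ ->; rewrite [LHS]surjective_pairing /= addr0.
under eq_bigr do rewrite [_ *: _]surjective_pairing /= scaler0.
rewrite sumE [LHS]surjective_pairing [RHS]surjective_pairing /=.
rewrite !scaler0 !addr0 add0r -euclid_basis.
by congr (_, _); rewrite [RHS]mulr1.
Qed.

Lemma enorm_sum (I : Type) (r : seq I) (F : I -> euclid R n) :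
  enorm (\sum_(i <- r) F i) <= \sum_(i <- r) enorm (F i).
Proof.
elim: r => [|i r IH]; first by rewrite !big_nil -(scale0r 0) enormZ normr0 mul0r.
by rewrite !big_cons; apply: le_trans (enormD _ _) _; rewrite lerD2l.
Qed.

(** The numerical factor allows for the n - 1 horizontal directions, the vertical one and time. *)
Lemma linear_enorm_le (df : {linear spacetime R n -> euclid R n}) (C : R) v :
  (forall i, enorm (df (xdir i, 0)) <= C) ->
  enorm (df (ydir, 0)) <= C -> enorm (df (0, 1)) <= C ->
  enorm (df v) <= C * n.-1.+2%:R * (enorm v.1 + `|v.2|).
Proof.
move=> hx hy ht; have C0 : 0 <= C by exact: le_trans (enorm_ge0 _) ht.
rewrite {1}[v]st_basis !linearD linear_sum /=.
have b1 : enorm (\sum_(i < n.-1) df (v.1.1 0 i *: (xdir i, 0))) <= C * n.-1%:R * enorm v.1.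
  apply: le_trans (enorm_sum _ _) _.
  apply: (@le_trans _ _ (\sum_(i < n.-1) C * enorm v.1)).
    apply: ler_sum => i _; rewrite linearZ /= enormZ mulrC.
    by rewrite ler_pM ?enorm_ge0// normr_coord_le.
  by rewrite sumr_const card_ord -[_ *+ n.-1]mulr_natr mulrAC.
have b2 : enorm (df (v.1.2 *: (ydir, 0))) <= C * enorm v.1.
  by rewrite linearZ /= enormZ mulrC ler_pM ?enorm_ge0// normr_height_le.
have b3 : enorm (df (v.2 *: (0, 1))) <= C * `|v.2|.
  by rewrite linearZ /= enormZ mulrC ler_pM ?enorm_ge0.
have := enormD (\sum_(i < n.-1) df (v.1.1 0 i *: (xdir i, 0)) + df (v.1.2 *: (ydir, 0)))
  (df (v.2 *: (0, 1))).
have := enormD (\sum_(i < n.-1) df (v.1.1 0 i *: (xdir i, 0))) (df (v.1.2 *: (ydir, 0))).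
have : 0 <= C * n.-1%:R * `|v.2| by rewrite !mulr_ge0.
have : 0 <= C * enorm v.1 by rewrite mulr_ge0// enorm_ge0.
have : 0 <= C * `|v.2| by rewrite mulr_ge0.
rewrite -[n.-1.+2]addn2 natrD; lra.
Qed.

(** The mean value theorem is scalar, so [u] is paired with [a] along the segment from [q] to [p],
    which stays in positive times by convexity. *)
Lemma C1_bounded_lipschitz u (C : R) :
  (forall p, 0 < p.2 -> differentiable u p) ->
  (forall p i, 0 < p.2 -> enorm ('D_(xdir i, 0) u p) <= C) ->
  (forall p, 0 < p.2 -> enorm ('D_(ydir, 0) u p) <= C) ->
  (forall p, 0 < p.2 -> enorm ('D_(0, 1) u p) <= C) ->
  forall p q a, 0 < p.2 -> 0 < q.2 ->
  `|dotp (u p - u q) a| <=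
    C * n.-1.+2%:R * (enorm (p.1 - q.1) + `|p.2 - q.2|) * enorm a.
Proof.
move=> du hx hy ht p q a p0 q0.
pose v := p - q; pose l (s : R) : spacetime R n := q + s *: v.
have l_gt0 (s : R) : s \in `[0, 1] -> 0 < (l s).2.
  rewrite in_itv /= => /andP[s0 s1].
  have -> : q.2 + s * (p.2 - q.2) = s * p.2 + (1 - s) * q.2 by ring.
  by move: s0; rewrite le_eqVlt => /orP[/eqP<-|s0]; nra.
pose h (s : R) := dotp a (u (l s)).
have hd (s : R) : s \in `[0, 1] -> is_derive s 1 h (dotp a ('d u (l s) v)).
  move=> /l_gt0 ls0.
  have dl : is_diff s l (fun r => r *: v).
    have := is_diffD (is_diff_cst q s) (is_diff_scalel s v).
    by rewrite add0r.
  have hda := (C1_linear (f := dotp a) (fun r x y => etrans (dotpDr _ _ _)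
    (congr1 (+%R^~ _) (dotpZr _ _ _))) (@continuous_dotpl R n a)).1 (u (l s)).
  have dul : is_diff s (u \o l) ('d u (l s) \o (fun r => r *: v)).
    exact: (is_diff_comp dl (differentiableP (du _ ls0))).
  have hh := is_diff_comp dul hda.
  have [hd1 hd2] := hh; apply: DeriveDef; first exact/derivable1_diffP.
  by rewrite deriveE// hd2 /= scale1r.
have hd_oo (s : R) : s \in `]0, 1[ -> is_derive s 1 h (dotp a ('d u (l s) v)).
  by move=> hs; apply: hd; exact: subset_itv_oo_cc hs.
have hc : {within `[0, 1], continuous h}.
  by apply: derivable_within_continuous => s hs; have [] := hd s hs.
have [c c01] := MVT_segment ler01 hd_oo hc.
rewrite subr0 mulr1 /h /l scale1r scale0r addr0 subrKC => e.
rewrite dotpBl !(dotpC _ a) e.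
have lc := l_gt0 _ c01; have dul := du _ lc.
apply: le_trans (normr_dotp_le _ _) _; rewrite mulrC ler_wpM2r ?enorm_ge0//.
apply: (@linear_enorm_le ('d u (l c)) C v).
- by move=> i; rewrite -deriveE//; exact: hx.
- by rewrite -deriveE//; exact: hy.
- by rewrite -deriveE//; exact: ht.
Qed.

End mean_value_bound.

(** * Size and regularity of the advection, up to time 0 *)

Section advection_bounds.
Context {R : realType} {n : nat}.

Lemma advection_differentiable (uperp : spacetime R n -> 'rV[R]_n.-1)
    (upar : 'rV[R]_n.-1 * R -> R) (w : R -> R) (p : spacetime R n) :
  Ck_on 2 positive_time uperp -> Ck_on 2 positive_time upar -> Ck_on 1 setT w ->
  0 < p.2 -> differentiable (advection uperp upar w) p.
Proof.
move=> [d1 _] [d2 _] [d3 _] p0.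
have hfst : is_diff p fst (fst : spacetime R n -> euclid R n).
  apply: DiffDef; first by apply: (linear_differentiable (f := fst)) => z; exact: cvg_fst.
  by apply: (diff_lin (f := fst)) => z; exact: cvg_fst.
have hsnd : is_diff p snd (snd : spacetime R n -> R).
  apply: DiffDef; first by apply: (linear_differentiable (f := snd)) => z; exact: cvg_snd.
  by apply: (diff_lin (f := snd)) => z; exact: cvg_snd.
have hfst' : differentiable (fst : euclid R n -> 'rV[R]_n.-1) p.1.
  by apply: (linear_differentiable (f := fst)) => z; exact: cvg_fst.
have hsnd' : differentiable (snd : euclid R n -> R) p.1.
  by apply: (linear_differentiable (f := snd)) => z; exact: cvg_snd.
have [dfst _] := hfst; have [dsnd _] := hsnd.
have h1 : differentiable (fun p : spacetime R n => (p.1.1, p.2)) p.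
  by apply: differentiable_pair => //; exact: (differentiable_comp dfst hfst').
have h2 : differentiable (fun p : spacetime R n => upar (p.1.1, p.2)) p.
  by apply: (differentiable_comp h1); exact: (d2 (p.1.1, p.2)).
have h3 : differentiable (fun p : spacetime R n => w p.1.2) p.
  apply: (differentiable_comp (differentiable_comp dfst hsnd')); exact: d3.
apply: differentiable_pair; first exact: d1.
exact: (differentiableM h2 h3).
Qed.

Lemma cvg_time_right {V W : normedModType R} (f : V * R -> W) x t :
  {within nonneg_time, continuous f} -> 0 <= t ->
  f (x, t + s) @[s --> 0^'+] --> f (x, t).
Proof.
move=> /subspace_continuousP h t0.
apply: cvg_trans (h (x, t) t0).
have c1 : (x, t + s) @[s --> (0 : R)] --> (x, t).
  apply: (@cvg_pair _ _ _ _ (nbhs x) (nbhs t)); first exact: cvg_cst.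
  have : t + s @[s --> (0 : R)] --> t + 0 by apply: cvgD; [exact: cvg_cst|exact: cvg_id].
  by rewrite addr0.
move=> B hB.
have h2 : \forall s \near (0 : R), nonneg_time (x, t + s) -> (f @^-1` B) (x, t + s).
  exact: (c1 _ hB).
apply: filterS h2 => s hs s0; apply: hs => /=.
by rewrite /nonneg_time /= addr_ge0// ltW.
Qed.

Lemma cvg_advection_right (uperp : spacetime R n -> 'rV[R]_n.-1)
    (upar : 'rV[R]_n.-1 * R -> R) (w : R -> R) z t :
  {within nonneg_time, continuous uperp} ->
  {within nonneg_time, continuous upar} -> 0 <= t ->
  advection uperp upar w (z, t + s) @[s --> 0^'+] --> advection uperp upar w (z, t).
Proof.
move=> c1 c2 t0.
apply: (@cvg_pair _ _ _ _ (nbhs (uperp (z, t))) (nbhs (upar (z.1, t) * w z.2))).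
  exact: cvg_time_right.
have : upar (z.1, t + s) * w z.2 @[s --> 0^'+] --> upar (z.1, t) * w z.2.
  by apply: cvgM; [exact: (cvg_time_right c2)|exact: cvg_cst].
exact.
Qed.

Lemma sqrt_sumsq_ge (m : nat) (F : 'I_m -> R) (a b B : R) :
  (forall i, 0 <= F i) -> 0 <= a -> 0 <= b ->
  Num.sqrt (\sum_i F i ^+ 2 + a ^+ 2 + b ^+ 2) <= B ->
  [/\ forall i, F i <= B, a <= B & b <= B].
Proof.
move=> F0 a0 b0; set s := _ + _ + _ => sB.
have sum0 : 0 <= \sum_i F i ^+ 2 by apply: sumr_ge0 => i _; exact: sqr_ge0.
have le_s x : 0 <= x -> x ^+ 2 <= s -> x <= B.
  move=> x0 xs; apply: le_trans sB; rewrite -(ger0_norm x0) -sqrtr_sqr.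
  by rewrite ler_sqrt// (le_trans _ xs)// sqr_ge0.
have := sqr_ge0 a; have := sqr_ge0 b; split.
- move=> i; apply: le_s => //.
  have : F i ^+ 2 <= \sum_i F i ^+ 2.
    by rewrite (bigD1 i)//= lerDl; apply: sumr_ge0 => j _; exact: sqr_ge0.
  by rewrite /s; lra.
- by apply: le_s => //; rewrite /s; lra.
- by apply: le_s => //; rewrite /s; lra.
Qed.

Lemma C1_norm_le (eps : R) (u : spacetime R n -> euclid R n) : 0 < eps ->
  (eps%:E * C1_norm u <= (1 / 100)%:E)%E ->
  forall p, 0 < p.2 -> [/\ eps * enorm (u p) <= 100^-1,
    forall i, enorm ('D_(xdir i, 0) u p) <= (100 * eps)^-1,
    enorm ('D_(ydir, 0) u p) <= (100 * eps)^-1 &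
    enorm ('D_(0, 1) u p) <= (100 * eps)^-1].
Proof.
move=> eps0; rewrite /C1_norm.
pose jac p := Num.sqrt (\sum_(i < n.-1) enorm ('D_(xdir i, 0) u p) ^+ 2 +
     enorm ('D_(ydir, 0) u p) ^+ 2 + enorm ('D_(0, 1) u p) ^+ 2).
rewrite -/jac; set a := ereal_sup _; set b := ereal_sup _ => hab p p0.
have ha : ((enorm (u p))%:E <= a)%E by apply: ereal_sup_ubound; exists p.
have hb : ((jac p)%:E <= b)%E by apply: ereal_sup_ubound; exists p.
have h : eps * (enorm (u p) + jac p) <= 100^-1.
  rewrite -lee_fin -[100^-1]mul1r EFinM; apply: le_trans hab.
  by apply: lee_wpmul2l; [rewrite lee_fin ltW|rewrite EFinD; exact: leeD].
have j0 : 0 <= jac p by exact: sqrtr_ge0.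
have u0 := enorm_ge0 (u p).
have hj : jac p <= (100 * eps)^-1.
  by rewrite invfM -ler_pdivrMr ?invr_gt0// invrK mulrC; nra.
have [hx hy ht] := sqrt_sumsq_ge (fun i => enorm_ge0 _) (enorm_ge0 _) (enorm_ge0 _) hj.
by split=> //; apply: le_trans h; rewrite ler_pM2l// lerDl.
Qed.

Section extension_to_time_0.
Variables (eps : R) (uperp : spacetime R n -> 'rV[R]_n.-1)
  (upar : 'rV[R]_n.-1 * R -> R) (w : R -> R).
Let u := advection uperp upar w.
Hypothesis eps_gt0 : 0 < eps.
Hypothesis C1u : (eps%:E * C1_norm u <= (1 / 100)%:E)%E.
Hypotheses (huperp : advection_coefficient uperp) (hupar : advection_coefficient upar).
Hypothesis hw : Ck_on 1 setT w.

Let cvg_u z t : 0 <= t -> u (z, t + s) @[s --> 0^'+] --> u (z, t).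
Proof.
by have [_ _ c1] := huperp; have [_ _ c2] := hupar; exact: cvg_advection_right.
Qed.

(** Time 0 matters for the profile [rho], and for the drift when alpha = oo, but the C1 bound is
    known at positive times only. So the estimate is proved at [t + s] and passes to the limit s ->
    0+. *)
Lemma normr_dotp_advection_le z t a : 0 <= t ->
  `|dotp (eps *: u (z, t)) a| <= 100^-1 * enorm a.
Proof.
move=> t0.
have c : `|dotp a (eps *: u (z, t + s))| @[s --> 0^'+] -->
    `|dotp a (eps *: u (z, t))|.
  apply: cvg_norm; apply: cvg_dotpr.
  exact: (cvgZl_tmp (k := eps) (@cvg_u z t t0)).
rewrite dotpC.
suff le_near : \forall s \near 0^'+, `|dotp a (eps *: u (z, t + s))| <= 100^-1 * enorm a.
  exact: (closed_cvg [set x : R | x <= 100^-1 * enorm a] (@closed_le _ _) le_near _ c).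
near=> s; have s0 : 0 < s by near: s; exact: nbhs_right_gt.
have [h _ _ _] := @C1_norm_le _ _ eps_gt0 C1u (z, t + s) (ltr_wpDl t0 s0).
apply: le_trans (normr_dotp_le _ _) _; rewrite mulrC ler_wpM2r ?enorm_ge0//.
by rewrite enormZ gtr0_norm.
Unshelve. all: by end_near. Qed.

Lemma advection_lipschitz : exists2 L, 0 <= L & forall z t z' t' a, 0 <= t -> 0 <= t' ->
  `|dotp (eps *: u (z, t) - eps *: u (z', t')) a| <=
    L * (enorm (z - z') + `|t - t'|) * enorm a.
Proof.
set C := (100 * eps)^-1.
have C0 : 0 <= C by rewrite invr_ge0 mulr_ge0// ltW.
exists (eps * (C * n.-1.+2%:R)) => [|z t z' t' a t0 t'0].
  by rewrite !mulr_ge0// ltW.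
have c : `|dotp a (eps *: (u (z, t + s) - u (z', t' + s)))| @[s --> 0^'+] -->
    `|dotp a (eps *: (u (z, t) - u (z', t')))|.
  apply: cvg_norm; apply: cvg_dotpr.
  exact: (cvgZl_tmp (k := eps) (cvgB (@cvg_u z t t0) (@cvg_u z' t' t'0))).
rewrite -scalerBr dotpC; set B := (X in _ <= X).
suff le_near : \forall s \near 0^'+,
    `|dotp a (eps *: (u (z, t + s) - u (z', t' + s)))| <= B.
  exact: (closed_cvg [set x : R | x <= B] (@closed_le _ _) le_near _ c).
have [d1 _ _] := huperp; have [d2 _ _] := hupar.
near=> s; have s0 : 0 < s by near: s; exact: nbhs_right_gt.
rewrite dotpZr normrM gtr0_norm// /B -!mulrA ler_pM2l// dotpC.
have := @C1_bounded_lipschitz R n u C _ _ _ _ (z, t + s) (z', t' + s) a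
  (ltr_wpDl t0 s0) (ltr_wpDl t'0 s0).
rewrite /= opprD addrACA subrr addr0 -!mulrA; apply.
- by move=> p p0; exact: advection_differentiable.
- by move=> p i p0; have [_ h _ _] := C1_norm_le eps_gt0 C1u p0; exact: h.
- by move=> p p0; have [_ _ h _] := C1_norm_le eps_gt0 C1u p0.
- by move=> p p0; have [_ _ _ h] := C1_norm_le eps_gt0 C1u p0.
Unshelve. all: by end_near. Qed.

Lemma epow_ge0 (e : R) alpha : 0 <= epow e alpha.
Proof. by case: alpha => //= r; exact: powR_ge0. Qed.

Lemma normr_dotp_drift_le alpha (p : spacetime R n) a : 0 < p.2 ->
  `|dotp (drift eps alpha u p) a| <= 100^-1 * enorm a.
Proof.
by move=> p0; apply: normr_dotp_advection_le; rewrite mulr_ge0 ?epow_ge0// ltW.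
Qed.

Lemma drift_lipschitz alpha : exists L, forall (p q : spacetime R n) a,
  0 < p.2 -> 0 < q.2 ->
  `|dotp (drift eps alpha u p - drift eps alpha u q) a| <=
    L * (enorm (p.1 - q.1) + `|p.2 - q.2|) * enorm a.
Proof.
have [L L0 hL] := advection_lipschitz; set k := epow eps alpha.
have k0 : 0 <= k by exact: epow_ge0.
exists (L * (1 + k)) => p q a p0 q0; apply: le_trans (hL _ _ _ _ _ _ _) _.
- by rewrite mulr_ge0// ltW.
- by rewrite mulr_ge0// ltW.
rewrite -mulrBr normrM (ger0_norm k0) ler_wpM2r ?enorm_ge0// -mulrA ler_wpM2l//.
by have := enorm_ge0 (p.1 - q.1); have := normr_ge0 (p.2 - q.2); nra.
Qed.

End extension_to_time_0.
End advection_bounds.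

(** * Comparison of eikonal solutions with cones *)

Section eikonal_cones.
Context {R : realType} {n : nat}.
Variables (rho : euclid R n -> R) (Lc : R).
Hypothesis Lc_ge1 : 1 <= Lc.
Hypothesis rho_lip : forall z z', rho z - rho z' <= Lc * enorm (z - z').
Hypothesis rho_sub : forall phi dphi z X, C1 phi dphi -> dphi z = dotp X ->
  (\forall z' \near z, rho z' - phi z' <= rho z - phi z) -> 99 / 100 * enorm X <= 1.
Hypothesis rho_super : forall phi dphi z X, C1 phi dphi -> dphi z = dotp X ->
  (\forall z' \near z, rho z - phi z <= rho z' - phi z') -> 1 <= 101 / 100 * enorm X.

(** The distance to [z0], smoothed at its vertex; [eta] is the error. *)
Let cone (eta : R) (z0 z : euclid R n) := Num.sqrt (dotp (z - z0) (z - z0) + eta ^+ 2).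

Let cone_gt0 eta z0 z : 0 < eta -> 0 < cone eta z0 z.
Proof. by move=> e0; rewrite sqrtr_gt0 ltr_wpDl ?dotpp_ge0// exprn_gt0. Qed.

Let sqr_cone eta z0 z : cone eta z0 z ^+ 2 = enorm (z - z0) ^+ 2 + eta ^+ 2.
Proof. by rewrite sqr_enorm sqr_sqrtr// addr_ge0 ?dotpp_ge0// sqr_ge0. Qed.

Let C1_cone eta z0 : 0 < eta ->
  C1 (cone eta z0) (fun z v => dotp ((cone eta z0 z)^-1 *: (z - z0)) v).
Proof.
move=> e0.
have pos z : 0 < dotp (z - z0) (z - z0) + eta ^+ 2.
  by rewrite ltr_wpDl ?dotpp_ge0// exprn_gt0.
have h := C1D (C1_sqr_dist z0) (C1_cst (eta ^+ 2)).
have := C1_comp (h := Num.sqrt) (h' := fun x => (2 * Num.sqrt x)^-1) h.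
move=> /(_ (fun z => is_derive1_sqrt (pos z))) H.
apply: C1_eq (H _) _ => [z|z v].
  apply: cvgV; first by rewrite gt_eqF// mulr_gt0// sqrtr_gt0.
  by apply: cvgM; [exact: cvg_cst|exact: sqrt_continuous].
by rewrite dotpZl addr0 invfM mulrACA mulVf ?mul1r ?pnatr_eq0.
Qed.

Let cone_ge eta z0 z : enorm (z - z0) <= cone eta z0 z.
Proof. by rewrite ler_sqrt ?lerDl ?sqr_ge0// addr_ge0 ?sqr_ge0 ?dotpp_ge0. Qed.

Let cone_le eta z0 z : 0 < eta -> cone eta z0 z <= enorm (z - z0) + eta.
Proof.
move=> e0; have d0 := enorm_ge0 (z - z0).
rewrite -ler_sqr ?nnegrE ?sqrtr_ge0 ?addr_ge0 ?(ltW e0)// sqr_cone.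
by nra.
Qed.

Let cone_center eta z0 : 0 < eta -> cone eta z0 z0 = eta.
Proof.
move=> e0; rewrite /cone subrr -sqr_enorm -(scale0r 0) enormZ normr0 mul0r.
by rewrite expr0n add0r sqrtr_sqr gtr0_norm.
Qed.

Let continuous_rho : continuous rho.
Proof. by apply: (enorm_lipschitz_continuous _ rho_lip); exact: lt_le_trans Lc_ge1. Qed.

Let near_ball (z0 z : euclid R n) (r : R) : enorm (z - z0) < r ->
  \forall z' \near z, enorm (z' - z0) < r.
Proof.
move=> h.
have c : enorm (z' - z0) @[z' --> z] --> enorm (z - z0).
  by apply: cvg_enorm; apply: cvgB; [exact: cvg_id|exact: cvg_cst].
by move/cvgr_lt : c => /(_ _ h).
Qed.

(** On the ball, minimize [rho] plus 19/20 of the cone. An interior minimum would give a test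
    gradient of norm at most 19/20 < 100/101, against [rho_super], so the minimizer is on the
    sphere. Comparison with [z0] costs 19/20 of [eta = r / 20], and (19/20)^2 >= 9/10. *)
Lemma cone_descent z0 (r : R) : 0 < r ->
  exists2 w, enorm (w - z0) = r & rho w <= rho z0 - 9 / 10 * r.
Proof.
move=> r0; pose eta := r / 20; have e0 : 0 < eta by rewrite divr_gt0.
have C1phi := C1Z (- (19 / 20)) (C1_cone z0 e0).
pose phi z := - (19 / 20) * cone eta z0 z.
have uc : usc_on [set z | enorm (z - z0) <= r] (fun z => phi z - rho z).
  apply: continuous_usc_on => z; apply: cvgB; last exact: continuous_rho.
  exact: (C1_continuous C1phi).
have z00 : enorm (z0 - z0) = 0 by rewrite subrr -(scale0r 0) enormZ normr0 mul0r.
have [|w wr wmax] := usc_on_max (@compact_enorm_ball _ _ z0 r) _ uc.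
  by exists z0; rewrite /= z00 ltW.
have wr_eq : enorm (w - z0) = r.
  apply/eqP; rewrite eq_le [X in X && _]wr /= leNgt; apply/negP => wlt.
  pose X := (- (19 / 20) * (cone eta z0 w)^-1) *: (w - z0).
  have touch : \forall z' \near w, rho w - phi w <= rho z' - phi z'.
    apply: filterS (near_ball wlt) => z' /ltW /wmax; lra.
  have := rho_super (X := X) C1phi _ touch => /(_ _); rewrite /X => h.
  have {h} := h ltac:(by apply/funext => v; rewrite !dotpZl mulrA).
  have c0 := cone_gt0 z0 w e0.
  have le1 : (cone eta z0 w)^-1 * enorm (w - z0) <= 1.
    by rewrite ler_pdivrMl// mulr1 cone_ge.
  rewrite enormZ normrM normrN (gtr0_norm (_ : 0 < _^-1)) ?invr_gt0// -mulrA.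
  rewrite (gtr0_norm (_ : 0 < 19 / 20)); lra.
exists w => //.
have := wmax z0; rewrite /= z00 /phi cone_center// => /(_ (ltW r0)).
have := cone_ge eta z0 w; rewrite wr_eq /eta; lra.
Qed.

(** Farther than [4 * eta] from its vertex, the cone of slope 21/20 is steeper than the 100/99
    allowed by [rho_sub]. So the maximum of [rho - phi] lies that close to [z0], where the constant
    [Lc], however large, costs little. *)
Lemma cone_growth z0 z : rho z - rho z0 <= 11 / 10 * enorm (z - z0).
Proof.
have Lc0 : 0 < Lc by exact: lt_le_trans Lc_ge1.
have := enorm_ge0 (z - z0); set d := enorm (z - z0); rewrite le_eqVlt => /orP[/eqP d0|d0].
  have /eqP : z - z0 = 0 by apply: enorm_eq0.
  by rewrite subr_eq0 -d0 mulr0 => /eqP ->; rewrite subrr.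
(* The smoothing error and the Lipschitz cost [4 * eta * Lc] together stay within d / 40; [delta]
   makes the quadratic term at [z] another d / 40, and 21/20 + 2/40 = 11/10. *)
pose eta := (d / 40) / (2 + 4 * Lc).
have e0 : 0 < eta by apply: divr_gt0; lra.
pose delta := 40^-1 / d.
have delta0 : 0 < delta by apply: divr_gt0; lra.
pose phi z' := 21 / 20 * cone eta z0 z' + delta * dotp (z' - z0) (z' - z0).
have C1phi : C1 phi _ := C1D (C1Z (21 / 20) (C1_cone z0 e0)) (C1Z delta (C1_sqr_dist z0)).
(* At a distance beyond [Lc / delta] the quadratic term outgrows [rho], so the maximum is not on the
   sphere of radius [r]. *)
pose r := Lc / delta + d + 1.
have r_gt : d < r by rewrite /r; have := divr_gt0 Lc0 delta0; lra.
have uc : usc_on [set z' | enorm (z' - z0) <= r] (fun z' => rho z' - phi z').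
  apply: continuous_usc_on => z'; apply: cvgB; first exact: continuous_rho.
  exact: (C1_continuous C1phi).
have z00 : enorm (z0 - z0) = 0 by rewrite subrr -(scale0r 0) enormZ normr0 mul0r.
have [|w wr wmax] := usc_on_max (@compact_enorm_ball _ _ z0 r) _ uc.
  by exists z0; rewrite /= z00; lra.
have phi_z0 : phi z0 = 21 / 20 * eta.
  by rewrite /phi cone_center// -sqr_enorm z00 expr0n mulr0 addr0.
set s := enorm (w - z0) in wr.
have s0 : 0 <= s by exact: enorm_ge0.
have := wmax z0; rewrite /= z00 phi_z0 => /(_ _) hw.
have {}hw := hw (ltW (le_lt_trans (ltW d0) r_gt)).
have phi_w : phi w = 21 / 20 * cone eta z0 w + delta * s ^+ 2.
  by rewrite /phi -sqr_enorm.
have c_gt0 := cone_gt0 z0 w e0.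
have c_eq := sqr_cone eta z0 w; rewrite -/s in c_eq.
have c_ge : eta <= cone eta z0 w.
  rewrite -ler_sqr ?nnegrE ?(ltW e0) ?(ltW c_gt0)// c_eq lerDr sqr_ge0//.
have w_lt : s < r.
  rewrite lt_neqAle wr andbT; apply/eqP => sr.
  have lip := rho_lip w z0; rewrite -/s in lip.
  have : Lc * s < delta * s ^+ 2.
    rewrite expr2 mulrA ltr_pM2r; last by rewrite sr; lra.
    by rewrite mulrC -ltr_pdivrMr// sr /r; lra.
  by move: hw; rewrite phi_w; lra.
pose X := (21 / 20 * (cone eta z0 w)^-1 + 2 * delta) *: (w - z0).
have touch : \forall z' \near w, rho z' - phi z' <= rho w - phi w.
  by apply: filterS (near_ball w_lt) => z' /ltW /wmax.
have := rho_sub (X := X) C1phi _ touch => /(_ _); rewrite /X => h.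
have {h} := h ltac:(by apply/funext => v; rewrite !dotpZl; ring).
have i_gt0 : 0 < (cone eta z0 w)^-1 by rewrite invr_gt0.
rewrite enormZ -/s gtr0_norm; last by rewrite addr_gt0// mulr_gt0.
move=> hX.
(* The ratio 26/27 is just above 100/99 * 20/21. *)
have sc : 27 * s <= 26 * cone eta z0 w.
  have : 21 / 20 * (cone eta z0 w)^-1 * s <= 100 / 99.
    have : 0 <= 2 * delta * s by apply: mulr_ge0 => //; lra.
    by move: hX; rewrite mulrDl; lra.
  rewrite -mulrA mulrCA -ler_pdivlMl ?invr_gt0// invrK => h.
  lra.
have s_le : s <= 4 * eta.
  rewrite leNgt; apply/negP => hs; have : 16 * eta ^+ 2 < s ^+ 2.
    have -> : 16 * eta ^+ 2 = (4 * eta) ^+ 2 by ring.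
    by rewrite ltr_sqr ?nnegrE//; lra.
  have : 729 * s ^+ 2 <= 676 * (s ^+ 2 + eta ^+ 2).
    rewrite -c_eq; have -> : 729 * s ^+ 2 = (27 * s) ^+ 2 by ring.
    have -> : 676 * cone eta z0 w ^+ 2 = (26 * cone eta z0 w) ^+ 2 by ring.
    by rewrite ler_sqr ?nnegrE//; lra.
  have := sqr_ge0 eta; move: (eta ^+ 2) (s ^+ 2) => *; lra.
have := wmax z (ltW r_gt); rewrite phi_w /phi -sqr_enorm -/d.
have := rho_lip w z0; rewrite -/s.
have := cone_le z0 z e0; rewrite -/d.
have : Lc * s <= Lc * (4 * eta) by rewrite ler_pM2l.
have : delta * d ^+ 2 = d / 40 by rewrite /delta expr2 mulrA divfK ?gt_eqF// mulrC.
have : (2 + 4 * Lc) * eta = d / 40.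
  by rewrite /eta mulrC divfK// gt_eqF// addr_gt0// mulr_gt0.
have : 0 <= delta * s ^+ 2 by rewrite mulr_ge0 ?sqr_ge0// ltW.
move: c_gt0; set dd := delta * d ^+ 2; set c := cone eta z0 w; set c' := cone eta z0 z.
set ds := delta * s ^+ 2; set e1 := Lc * s.
have -> : (2 + 4 * Lc) * eta = 2 * eta + Lc * (4 * eta) by ring.
lra.
Qed.

End eikonal_cones.

(** * Linear bounds for the travelling wave profile *)

Section profile_bounds.
Context {R : realType} {n : nat}.
Implicit Types z w : euclid R n.

Lemma enorm_vertical (x : 'rV[R]_n.-1) (y y' : R) :
  enorm ((x, y) - (x, y') : euclid R n) = `|y - y'|.
Proof.
rewrite /enorm /dotp /= subrr big1 ?add0r => [|i _]; last by rewrite mxE mul0r.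
by rewrite -expr2 sqrtr_sqr.
Qed.

(** The bounds are piecewise linear in the height: between 1/5 and 11/10 of it above 0, and the
    other way round below 0. *)
Lemma profile_bounds (rho : euclid R n -> R) :
  (forall z z', rho z - rho z' <= 11 / 10 * enorm (z - z')) ->
  (forall z0 (r : R), 0 < r ->
    exists2 w, enorm (w - z0) = r & rho w <= rho z0 - 9 / 10 * r) ->
  (forall x, rho (x, 0) = 0) ->
  (forall e : R, 0 < e -> \forall y \near +oo, forall x, - e <= rho (x, y)) ->
  forall z, 13 / 20 * z.2 - 9 / 20 * `|z.2| <= rho z <= 13 / 20 * z.2 + 9 / 20 * `|z.2|.
Proof.
move=> growth descent rho0 rho_inf.
have height w z : `|w.2 - z.2| <= enorm (w - z) by exact: (normr_height_le (w - z)).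
have lipP z : rho z <= 11 / 10 * `|z.2|.
  have := growth z (z.1, 0); rewrite rho0 subr0.
  by case: z => x y /=; rewrite enorm_vertical subr0.
have lipN z : - (11 / 10 * `|z.2|) <= rho z.
  have := growth (z.1, 0) z; rewrite rho0 sub0r.
  by case: z => x y /=; rewrite enorm_vertical sub0r normrN; lra.
have rho_ge0 z : 0 <= z.2 -> 0 <= rho z.
  move=> z_ge0; rewrite leNgt; apply/negP => rho_lt0.
  have [Y [_ hY]] := rho_inf 1 ltr01.
  pose E := [set rho z' | z' in [set z' : euclid R n | 0 <= z'.2]].
  have E_inf : has_inf E.
    split; first by exists (rho z), z.
    exists (- (11 / 10 * `|Y|) - 1) => _ [z' /= z'0 <-].
    have [yY|Yy] := leP z'.2 Y.
      have := lipN z'; rewrite (ger0_norm z'0); have := ler_norm Y; lra.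
    have := hY z'.2 Yy z'.1; rewrite -surjective_pairing.
    by have := normr_ge0 Y; lra.
  have m_lt0 : inf E < 0.
    apply: le_lt_trans rho_lt0; apply: ge_inf; first by case: E_inf.
    by exists z.
  (* A near-minimizer within this tolerance lies higher than [- inf E / 2]. Descending by its height
     stays in y >= 0 and lowers [rho] by more than 9/20 of [- inf E], hence below the infimum. *)
  have tau0 : 0 < - inf E / 4 by lra.
  have [_ [z' /= z'0 <-] hz'] := inf_adherent tau0 E_inf.
  have y'_gt : - (1 / 2) * inf E < z'.2.
    by have := lipN z'; rewrite (ger0_norm z'0); lra.
  have y'0 : 0 < z'.2 by lra.
  have [w wr hw] := descent z' _ y'0.
  have w0 : 0 <= w.2.
    by have := height w z'; rewrite wr ler_norml; lra.
  have : inf E <= rho w by apply: ge_inf; [case: E_inf|exists w].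
  lra.
move=> z; have [z0|z0] := leP 0 z.2.
  rewrite (ger0_norm z0); have := lipP z; rewrite (ger0_norm z0) => up.
  move: z0; rewrite le_eqVlt => /orP[/eqP z0|z0].
    by have := rho_ge0 z; rewrite -z0 in up *; move=> /(_ (lexx _)); lra.
  have [w wr hw] := descent z _ z0.
  have w0 : 0 <= w.2 by have := height w z; rewrite wr ler_norml; lra.
  by have := rho_ge0 w w0; lra.
rewrite (ltr0_norm z0); have := lipN z; rewrite (ltr0_norm z0) => low.
have h0 : 0 < - z.2 by lra.
have [w wr hw] := descent (z.1, 0) _ h0; rewrite rho0 in hw.
have w0 : w.2 < 0.
  rewrite ltNge; apply/negP => /rho_ge0; lra.
have := lipN w; rewrite (ltr0_norm w0) => lw.
(* With h = [- z.2], growth forces the depth of [w] to be at least 9 h / 11. As [w] is at distance h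
   from [(z.1, 0)], its squared distance to [z] is at most 4 h^2 / 11 <= (61/100 h)^2, and 9/10 -
   11/10 * 61/100 >= 1/5. *)
have wz : enorm (w - z) <= - (61 / 100 * z.2).
  have : enorm (w - (z.1, 0)) ^+ 2 = z.2 ^+ 2 by rewrite wr sqrrN.
  rewrite -ler_sqr ?nnegrE ?enorm_ge0//; last lra.
  rewrite !sqr_enorm /dotp /=; set s := \sum_i _; rewrite subr0 => e.
  have -> : s + (w.2 - z.2) * (w.2 - z.2) = s + w.2 * w.2 - 2 * (w.2 * z.2) + z.2 ^+ 2.
    by ring.
  rewrite e; nra.
by have := growth z w; rewrite enormB; lra.
Qed.

(** The advection term is at most a hundredth of the gradient, which turns the equation into two
    eikonal inequalities; [rho] is continuous, so its envelopes are [rho] itself. *)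
Lemma ptw_profile_bounds (eps : R) (u : spacetime R n -> euclid R n) rho :
  (forall z a, `|dotp (eps *: u (z, 0)) a| <= 100^-1 * enorm a) ->
  ptw_profile eps u rho ->
  forall z, 13 / 20 * z.2 - 9 / 20 * `|z.2| <= rho z <= 13 / 20 * z.2 + 9 / 20 * `|z.2|.
Proof.
move=> b_le [rho_lip [_ sub super] rho0 rho_inf _].
have [Lc Lc1 lip] : exists2 Lc, 1 <= Lc &
    forall z z', rho z - rho z' <= Lc * enorm (z - z').
  have [M [_ hM]] := rho_lip; pose Lc := `|M| + 1.
  exists Lc; first by rewrite /Lc; have := normr_ge0 M; lra.
  move=> z z'; have := hM Lc _ (z, z') (conj I I) => /=.
  have MLc : M < Lc by rewrite /Lc; have := ler_norm M; lra.
  move=> /(_ MLc) h; apply: le_trans (ler_norm _) (le_trans h _).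
  apply: ler_wpM2l (normr_le_enorm _).
  by rewrite /Lc; have := normr_ge0 M; lra.
have crho : continuous rho.
  by apply: (enorm_lipschitz_continuous _ lip); exact: lt_le_trans Lc1.
have uscE z : usc_env setT rho z = (rho z)%:E by exact: usc_env_continuous.
have lscE z : lsc_env setT rho z = (rho z)%:E by exact: lsc_env_continuous.
have rho_sub phi dphi z X : C1 phi dphi -> dphi z = dotp X ->
    (\forall z' \near z, rho z' - phi z' <= rho z - phi z) -> 99 / 100 * enorm X <= 1.
  move=> C1phi eX touch.
  have := sub phi z I (C1_Ck_on _ C1phi) _.
  have -> : (fun v => 'D_v phi z) = dotp X.
    by apply/funext => v; rewrite -eX; exact: C1_derive C1phi.
  rewrite /ptw_operator gradient_dotp -dotpZl => h.
  have {h} := h _; have := b_le z X; rewrite ler_norml => /andP[h _] h'.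
  have : dotp (eps *: u (z, 0)) X + enorm X - 1 <= 0.
    apply: h'; apply: filterS touch => z'; rewrite !uscE.
    by move: (rho z') (rho z) (phi z') (phi z) => *.
  by lra.
have rho_super phi dphi z X : C1 phi dphi -> dphi z = dotp X ->
    (\forall z' \near z, rho z - phi z <= rho z' - phi z') -> 1 <= 101 / 100 * enorm X.
  move=> C1phi eX touch.
  have := super phi z I (C1_Ck_on _ C1phi) _.
  have -> : (fun v => 'D_v phi z) = dotp X.
    by apply/funext => v; rewrite -eX; exact: C1_derive C1phi.
  rewrite /ptw_operator gradient_dotp -dotpZl => h.
  have {h} := h _; have := b_le z X; rewrite ler_norml => /andP[_ h] h'.
  have : 0 <= dotp (eps *: u (z, 0)) X + enorm X - 1.
    apply: h'; apply: filterS touch => z'; rewrite !lscE.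
    by move: (rho z') (rho z) (phi z') (phi z) => *.
  by lra.
apply: profile_bounds => //.
  by move=> z z'; exact: (cone_growth Lc1 lip rho_sub).
by move=> z0 r; exact: (cone_descent Lc1 lip rho_super).
Qed.

End profile_bounds.

(** * Comparison of fronts *)

Section fronts.
Context {R : realType} {n : nat}.

(** What comparison uses of the initial data, common to front-like functions and to the profile
    [rho]. *)
Definition sandwiched (g : euclid R n -> R) := exists low up : R -> R,
  [/\ continuous low /\ continuous up,
      {homo low : x y / x < y} /\ {homo up : x y / x < y},
      low 0 = 0 /\ up 0 = 0 & forall z, low z.2 <= g z <= up z.2].

Lemma lipschitz_segments_continuous (f : R -> R) :
  (forall a b, [lipschitz f y | y in `[a, b]]) -> continuous f.
Proof.
move=> lip y; apply/cvgrPdist_lt => e e0.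
have [M [_ hM]] := lip (y - 1) (y + 1); pose L := `|M| + 1.
have L0 : 0 < L by rewrite /L; have := normr_ge0 M; lra.
near=> y'.
have y'y : `|y - y'| < 1 by near: y'; exact: (@cvgr_dist_lt _ _ _ _ _ id y cvg_id).
have y'e : `|y - y'| < e / L.
  by near: y'; apply: (@cvgr_dist_lt _ _ _ _ _ id y cvg_id); exact: divr_gt0.
have := hM L _ (y, y') _ => /= h.
have ML : M < L by rewrite /L; have := ler_norm M; lra.
apply: le_lt_trans (h ML _) _; last by rewrite mulrC -ltr_pdivlMr.
split; rewrite /= in_itv/=; first lra.
by move: y'y; rewrite ltr_norml; lra.
Unshelve. all: by end_near. Qed.

(** The mean value theorem covers intervals without 0 in their interior; the others are split at
    0. *)
Lemma increasing_off0 (f : R -> R) : continuous f ->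
  Ck_on 1 [set y | y != 0] f -> (forall y, y != 0 -> 0 < derive1 f y) ->
  {homo f : x y / x < y}.
Proof.
move=> cf [df _] f'0.
have incr x y : x < y -> (forall c, x < c < y -> c != 0) -> f x < f y.
  move=> xy n0.
  have fd c : c \in `]x, y[ -> is_derive c 1 f (derive1 f c).
    rewrite in_itv /= => /n0 c0; rewrite derive1E; apply: DeriveDef => //.
    by apply/derivable1_diffP; exact: df.
  have [c cxy fxy] := MVT xy fd (continuous_subspaceT cf).
  by rewrite -subr_gt0 fxy mulr_gt0 ?subr_gt0// f'0// n0.
move=> x y xy; have [x0|x0] := leP 0 x.
  by apply: incr => // c /andP[xc _]; rewrite gt_eqF// (le_lt_trans x0).
have [y0|y0] := leP y 0.
  by apply: incr => // c /andP[_ cy]; rewrite lt_eqF// (lt_le_trans cy).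
apply: (@lt_trans _ _ (f 0)); apply: incr => // c /andP[? ?].
  by rewrite lt_eqF.
by rewrite gt_eqF.
Qed.

Lemma front_like_sandwiched (g : euclid R n -> R) : front_like g -> sandwiched g.
Proof.
move=> [_ [low [up [lip [Cl Cu] pos le [l0 u0]]]]]; exists low, up.
have cl : continuous low.
  by apply: lipschitz_segments_continuous => a b; have [] := lip a b.
have cu : continuous up.
  by apply: lipschitz_segments_continuous => a b; have [] := lip a b.
by split=> //; split; apply: increasing_off0 => // y /pos[].
Qed.

Lemma ptw_profile_sandwiched (rho : euclid R n -> R) :
  (forall z, 13 / 20 * z.2 - 9 / 20 * `|z.2| <= rho z
               <= 13 / 20 * z.2 + 9 / 20 * `|z.2|) -> sandwiched rho.
Proof.
move=> h; exists (fun y => 13 / 20 * y - 9 / 20 * `|y|), (fun y => 13 / 20 * y + 9 / 20 * `|y|).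
split=> //; last by rewrite normr0 !mulr0 addr0 subr0.
  have cN : continuous (fun y : R => 9 / 20 * `|y|).
    by move=> y; apply: cvgM; [exact: cvg_cst|exact: norm_continuous].
  have cL : continuous (fun y : R => 13 / 20 * y).
    by move=> y; apply: cvgM; [exact: cvg_cst|exact: cvg_id].
  by split=> y; [apply: cvgB|apply: cvgD]; [exact: cL|exact: cN|exact: cL|exact: cN].
split=> x y xy; have := ler_dist_dist y x; rewrite (gtr0_norm (_ : 0 < y - x)) ?subr_gt0//.
  by rewrite ler_norml; lra.
by rewrite ler_norml; lra.
Qed.

Lemma small_right (f : R -> R) (e : R) : continuous f -> f 0 = 0 -> 0 < e ->
  exists2 y, 0 < y & f y < e.
Proof.
move=> cf f0 e0; have f0e : f 0 < e by rewrite f0.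
have /cvgr_lt := @cf 0 => /(_ _ f0e) => /nbhs_ballP[d /= d0 hd].
exists (d / 2); first by rewrite divr_gt0.
by apply: hd; rewrite /ball /= sub0r normrN gtr0_norm; lra.
Qed.

Section comparison_of_solutions.
Variables (eps : R) (alpha : \bar R) (u : spacetime R n -> euclid R n).
Hypothesis drift_le : forall (p : spacetime R n) a, 0 < p.2 ->
  `|dotp (drift eps alpha u p) a| <= 100^-1 * enorm a.
Hypothesis drift_lip : exists L, forall (p q : spacetime R n) a,
  0 < p.2 -> 0 < q.2 ->
  `|dotp (drift eps alpha u p - drift eps alpha u q) a| <=
    L * (enorm (p.1 - q.1) + `|p.2 - q.2|) * enorm a.
Variables (g h : euclid R n -> R) (G V : spacetime R n -> R).
Hypotheses (solG : G_solution eps alpha u g G) (solV : G_solution eps alpha u h V).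

(** The shifts separate the initial data by [dl], which reduces the hypothesis of [comparison] to a
    dichotomy on the height. *)
Lemma shifted_comparison (up low : R -> R) (c1 c2 dl : R) :
  continuous up -> continuous low ->
  (forall z, g z <= up z.2) -> (forall z, low z.2 <= h z) -> 0 < dl ->
  (forall y, up y + c1 <= - dl \/ - low y + c2 <= - dl) ->
  forall p : spacetime R n, 0 < p.2 -> 0 < G p + c1 -> - V p + c2 <= 0.
Proof.
move=> cup clow gup hlow dl0 init p p0 Gp.
have [_ bG _ iG] := solG; have [_ bV _ iV] := solV.
have bNV := locally_bounded_onN bV.
have [L hL] := drift_lip.
have cup2 : continuous (fun z : euclid R n => up z.2).
  by move=> z; apply: (cvg_comp _ _ (@cvg_snd _ _ (nbhs z.1) (nbhs z.2) _)); exact: cup.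
have clow2 : continuous (fun z : euclid R n => - low z.2).
  move=> z; apply: cvgN.
  by apply: (cvg_comp _ _ (@cvg_snd _ _ (nbhs z.1) (nbhs z.2) _)); exact: clow.
have init0 z : usc_envR nonneg_time G (z, 0) + c1 <= - dl \/
               usc_envR nonneg_time (\- V) (z, 0) + c2 <= - dl.
  have nn : nonneg_time (z, 0 : R) by rewrite /nonneg_time /=.
  have [i1 _] := iG z; have [_ i2] := iV z.
  have h1 : usc_envR nonneg_time G (z, 0) <= up z.2.
    rewrite -lee_fin -(usc_envRE bG nn); apply: le_trans i1 _.
    exact: (usc_env_continuous_le z cup2 gup).
  have h2 : usc_envR nonneg_time (\- V) (z, 0) <= - low z.2.
    rewrite -lee_fin -(usc_envRE bNV nn).
    move: i2; rewrite !lsc_envE leeN2 => i2; apply: le_trans i2 _.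
    by apply: (usc_env_continuous_le z clow2) => z'; rewrite lerN2.
  move: (usc_envR _ G _) (usc_envR _ (\- V) _) h1 h2 => a b h1 h2.
  by have [?|?] := init z.2; [left|right]; lra.
have nnp : nonneg_time p by exact: ltW.
have := comparison drift_le hL (usc_onDr (c := c1) (usc_envR_usc bG))
  (usc_onDr (c := c2) (usc_envR_usc bNV)) (G_test_sub (c := c1) solG) (G_test_opp_super (c := c2) solV)
  dl0 init0 p0.
have := usc_envR_ge bG nnp; have := usc_envR_ge bNV nnp => /=.
move: (usc_envR _ G p) (usc_envR _ (\- V) p) => a b h1 h2 h3.
by have := h3 (lt_le_trans Gp (lerD h2 (lexx c1))); lra.
Qed.

Lemma front_comparison : sandwiched g -> sandwiched h ->
  forall p : spacetime R n, 0 < p.2 -> (0 < G p -> 0 < V p) /\ (V p < 0 -> G p < 0).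
Proof.
move=> [low' [up [[_ cup] [_ iup] [_ up0] hg]]].
move=> [low [up' [[clow _] [ilow _] [low0 _] hh]]].
have gup z : g z <= up z.2 by have /andP[] := hg z.
have hlow z : low z.2 <= h z by have /andP[] := hh z.
have up_le x y : x <= y -> up x <= up y.
  by rewrite le_eqVlt => /orP[/eqP->|/iup/ltW].
have low_le x y : x <= y -> low x <= low y.
  by rewrite le_eqVlt => /orP[/eqP->|/ilow/ltW].
have comp := shifted_comparison cup clow gup hlow.
move=> p p0; split=> [Gp|Vp].
  (* Up to height [y0] the data of [G], lowered by [G p / 2], are below [- dl]; above it those of
     [- V], raised by only [low y0 / 2], are. The latter shift makes the conclusion [0 < V p]
     strict. *)
  have [y0 y00 upy0] := small_right cup up0 (divr_gt0 Gp (ltr0n R 4)).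
  have m0 := ilow _ _ y00; rewrite low0 in m0.
  pose dl := Num.min (G p / 4) (low y0 / 2).
  have dl0 : 0 < dl by rewrite lt_min !divr_gt0.
  have [dl1 dl2] : dl <= G p / 4 /\ dl <= low y0 / 2.
    by split; rewrite ge_min lexx ?orbT.
  have := comp (- (G p / 2)) (low y0 / 2) dl dl0 _ p p0 => H.
  suff : - V p + low y0 / 2 <= 0 by lra.
  apply: H; last by lra.
  by move=> y; have [/up_le yy|/ltW/low_le yy] := leP y y0; [left|right]; lra.
(* The mirror image: [y0] is sought below height 0, and [G] is now raised by a positive amount so
   that [G p = 0] is excluded too. *)
have cN : continuous (fun y => - low (- y)).
  move=> y; apply: cvgN.
  have oppy : (- y') @[y' --> y] --> - y by apply: cvgN; exact: cvg_id.
  exact: (cvg_comp _ _ oppy (@clow (- y))).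
have N0 : - low (- 0) = 0 by rewrite oppr0 low0 oppr0.
have V4 : 0 < - V p / 4 by lra.
have [y0 y00 lowy0] := small_right cN N0 V4.
have m0 : up (- y0) < 0 by rewrite -up0; apply: iup; lra.
pose dl := Num.min (- V p / 4) (- up (- y0) / 2).
have dl0 : 0 < dl by rewrite lt_min V4 divr_gt0// oppr_gt0.
have [dl1 dl2] : dl <= - V p / 4 /\ dl <= - up (- y0) / 2.
  by split; rewrite ge_min lexx ?orbT.
have := comp (- up (- y0) / 2) (V p / 2) dl dl0 _ p p0 => H.
rewrite ltNge; apply/negP => Gp.
suff : - V p + V p / 2 <= 0 by lra.
apply: H; last by lra.
by move=> y; have [/low_le yy|/ltW/up_le yy] := leP (- y0) y; [right|left]; lra.
Qed.

End comparison_of_solutions.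
End fronts.

(** * Equality of the fronts *)

Theorem proposition2p4 (R : realType) (n : nat) (hn : (2 <= n)%N)
    (d : measure_display) (Omega : measurableType d) (P : probability Omega R)
    (w : R -> {RV P >-> R})
    (uperp : Omega -> spacetime R n -> 'rV[R]_n.-1)
    (upar : Omega -> 'rV[R]_n.-1 * R -> R)
    (eps : R) (alpha : \bar R)
    (G0 : Omega -> euclid R n -> R)
    (G Gptw : Omega -> spacetime R n -> R)
    (u := fun om => advection (uperp om) (upar om) (fun y => w y om)) :
  mild_white_noise w ->
  {ae P, forall om, advection_coefficient (uperp om) /\
                    advection_coefficient (upar om)} ->
  0 < eps ->
  {ae P, forall om, (eps%:E * C1_norm (u om) <= (1 / 100)%:E)%E} ->
  (1 <= alpha)%E ->
  {ae P, forall om, front_like (G0 om)} ->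
  {ae P, forall om, G_solution eps alpha (u om) (G0 om) (G om)} ->
  {ae P, forall om, perturbed_traveling_wave eps alpha (u om) (Gptw om)} ->
  {ae P, forall om,
    (forall t, 0 < t -> zero_level_set (G om) t = zero_level_set (Gptw om) t) /\
    nonpos_set (G om) = nonpos_set (Gptw om)}.
Proof.
move=> [[M _ hw] _ _ _ _] hu eps0 hC _ hG0 hG hV.
apply: filter_app hw; apply: filter_app hu; apply: filter_app hC.
apply: filter_app hG0; apply: filter_app hG; apply: filter_app hV.
apply: filterE => om [rho ptw solV] solG /front_like_sandwiched sG0 C1u [hperp hpar] [hw _].
have drift_le := @normr_dotp_drift_le R n eps _ _ _ eps0 C1u hperp hpar alpha.
have drift_lip := drift_lipschitz eps0 C1u hperp hpar hw alpha.
have srho : sandwiched rho.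
  apply: ptw_profile_sandwiched; apply: ptw_profile_bounds ptw => z a.
  exact: (normr_dotp_advection_le eps0 C1u hperp hpar _ _ (lexx 0)).
(* Both data are sandwiched and both solutions have the same drift, so the comparison runs in both
   directions and the signs of the two solutions agree. *)
have GV := front_comparison drift_le drift_lip solG solV sG0 srho.
have VG := front_comparison drift_le drift_lip solV solG srho sG0.
have pos p : 0 < p.2 -> (0 < G om p) = (0 < Gptw om p).
  by move=> p0; apply/idP/idP; [exact: (GV p p0).1|exact: (VG p p0).1].
have neg p : 0 < p.2 -> (G om p < 0) = (Gptw om p < 0).
  by move=> p0; apply/idP/idP; [exact: (VG p p0).2|exact: (GV p p0).2].
split.
  move=> t t0; apply/seteqP; split=> z /= /eqP.
    by rewrite eq_le !leNgt pos// neg// -!leNgt -eq_le => /eqP.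
  by rewrite eq_le !leNgt -pos// -neg// -!leNgt -eq_le => /eqP.
apply/seteqP; split=> p [p0 hp]; split=> //; move: hp; rewrite !leNgt.
  by rewrite pos.
by rewrite pos.
Qed.
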